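(* Let $B$ be the unit ball of a nonseparable weakly compactly generated Banach $\mathcal K$-space. Then $A_0(B,c_0)$ is finite while $A(B,c_0)$ is not.
   Context: $c_0$ is the Banach space of all null sequences of scalars with the sup norm. A Banach space is weakly compactly generated (WCG) if it contains a weakly compact subset whose linear span is dense in the whole space. A Banach space $X$ over the scalar field $\mathbb K$ is a $\mathcal K$-space if every quasilinear function $f:X\to\mathbb K$ is the sum of a linear (not necessarily continuous) map and a bounded homogeneous map. Here $f$ is homogeneous if $f(\lambda x)=\lambda f(x)$ for all scalars $\lambda$ and $x\in X$; quasilinear if it is homogeneous and $|f(x+y)-f(x)-f(y)|\le Q(\|x\|+\|y\|)$ for some constant $Q$ and all $x,y\in X$; and a homogeneous map is bounded if it is uniformly bounded on the unit ball. Let $D$ be a convex set in a linear space and $Y$ a Banach space. For $\delta\ge0$, a function $f:D\to Y$ is $\delta$-affine if $\|f(tx+(1-t)y)-tf(x)-(1-t)f(y)\|_Y\le\delta$ for all $x,y\in D$ and $t\in[0,1]$; affine functions are the $0$-affine ones. $A_0(D,Y)$ is the infimum of those constants $C$ for which the following holds: if $f:D\to Y$ is a uniformly bounded $\delta$-affine function, then there is an affine function $a:D\to Y$ such that $\|f(x)-a(x)\|_Y\le C\delta$ for all $x\in D$. $A(D,Y)$ is defined in the same way omitting the words ''uniformly bounded''. (The value is $\infty$ if there is no such $C$.) *)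

(* Defs.v *)
From HB Require Import structures.
From mathcomp Require Import all_boot all_order all_algebra.
From mathcomp Require Import all_classical all_reals all_analysis.
From mathcomp Require Export complex.

Set Implicit Arguments.
Unset Strict Implicit.
Unset Printing Implicit Defensive.

Import Order.TTheory GRing.Theory Num.Theory.
Import numFieldNormedType.Exports.

Local Open Scope classical_set_scope.
Local Open Scope ring_scope.

(* Everything is stated over an abstract scalar field [K : numFieldType], so   *)
(* that [K := R] and [K := R[i]] are covered at once. Norms, and the constants *)
(* bounding them, live in [K]; in [R[i]] the relation [x <= y] means that      *)
(* [y - x] is a nonnegative real, so such constants are automatically real.    *)

Section NullSequences.
Variable K : numFieldType.

Definition null_seq : {pred nat -> K} :=
  fun u => `[< u @ \oo --> (0 : K) >].

Lemma null_seqP (u : nat -> K) :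
  reflect (u @ \oo --> (0 : K)) (u \in null_seq).
Proof. exact: asboolP. Qed.

Lemma null_seq_submod_closed : submod_closed null_seq.
Proof.
split=> [|a u v /null_seqP u0 /null_seqP v0]; apply/null_seqP.
  exact: cvg_cst.
have -> : (0 : K) = a *: (0 : K^o) + 0 by rewrite scaler0 addr0.
by apply: cvgD => //; apply: cvgZl_tmp.
Qed.

HB.instance Definition _ :=
  GRing.isSubmodClosed.Build K (nat -> K) null_seq null_seq_submod_closed.

Record c0 := C0 { c0_val :> nat -> K; _ : c0_val \in null_seq }.

HB.instance Definition _ := [isSub for c0_val].
HB.instance Definition _ := gen_eqMixin c0.
HB.instance Definition _ := gen_choiceMixin c0.
HB.instance Definition _ := [SubChoice_isSubLmodule of c0 by <:].

Definition c0_norm (u : c0) : K := supremum 0 (range (fun n => `|u n|)).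

Lemma c0_norm_max (u : c0) :
  exists2 m, c0_norm u = `|u m| & forall n, `|u n| <= `|u m|.
Proof.
suff [m um] : exists m, forall n, `|u n| <= `|u m|.
  exists m => //.
  have supm : supremums (range (fun n => `|u n|)) `|u m|.
    by split=> [_ [n _ <-]|y]; [exact: um|apply; exists m].
  rewrite /c0_norm /supremum ifF; last first.
    by apply/eqP => /seteqP[+ _] => /(_ `|u m|); apply; exists m.
  by apply: xget_subset1 => //; exact: is_subset1_supremums.
have fin_max N : exists m, forall n, (n <= N)%N -> `|u n| <= `|u m|.
  elim: N => [|N [m um]]; first by exists 0%N => n; rewrite leqn0 => /eqP ->.
  have [le|le] := orP (real_leVge (normr_real (u N.+1)) (normr_real (u m))).
    by exists m => n; rewrite leq_eqVlt => /predU1P[-> //|/um].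
  exists N.+1 => n; rewrite leq_eqVlt => /predU1P[-> //|/um/le_trans]; exact.
have [[k uk]|u0] := pselect (exists k, u k != 0); last first.
  exists 0%N => n; suff -> : u n = 0 by rewrite normr0.
  by apply/eqP/negPn/negP => un; apply: u0; exists n.
have /null_seqP/cvgr0Pnorm_lt/(_ `|u k|) := valP u.
rewrite normr_gt0 => /(_ uk)[N _ uN].
have [m um] := fin_max (maxn N k); exists m => n.
have [nN|Nn] := leqP n (maxn N k); first exact: um.
apply: (@le_trans _ _ `|u k|); last by apply: um; rewrite leq_maxr.
by apply/ltW/uN; rewrite /= (leq_trans (leq_maxl N k))// ltnW.
Qed.

Lemma c0_ler_normD u v : c0_norm (u + v) <= c0_norm u + c0_norm v.
Proof.
have [i -> _] := c0_norm_max (u + v).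
have [j -> uj] := c0_norm_max u; have [k -> vk] := c0_norm_max v.
by rewrite (le_trans (ler_normD _ _))// lerD.
Qed.

Lemma c0_normrZ (a : K) u : c0_norm (a *: u) = `|a| * c0_norm u.
Proof.
have [i -> ui] := c0_norm_max (a *: u); have [j -> uj] := c0_norm_max u.
have E n : `|(a *: u) n| = `|a| * `|u n| by rewrite -normrM.
by apply/le_anti; rewrite {1}E ler_wpM2l//= -E ui.
Qed.

Lemma c0_normr0_eq0 u : c0_norm u = 0 -> u = 0.
Proof.
have [m -> um] := c0_norm_max u => um0; apply/val_inj/funext => n.
by apply/eqP; rewrite -normr_le0 -um0.
Qed.

HB.instance Definition _ :=
  Lmodule_isNormed.Build K c0 c0_ler_normD c0_normrZ c0_normr0_eq0.

End NullSequences.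

Section BanachSpaces.
Variables (K : numFieldType) (X : normedModType K).

Definition separable := exists2 S : set X, countable S & dense S.

Definition dual := {f : {linear X -> K^o} | continuous f}.

(* [X] with its weak topology, the coarsest one making every element of the    *)
(* continuous dual continuous.                                                 *)
Definition weak_space := sup_topology
  (fun f : dual => Topological.class (initial_topology (sval f : X -> K^o))).

HB.instance Definition _ := Topological.on weak_space.

Definition linear_span (W : set X) : set X :=
  [set x | exists n (c : 'I_n -> K) (w : 'I_n -> X),
     (forall i, W (w i)) /\ x = \sum_i c i *: w i].

Definition weakly_compactly_generated :=
  exists2 W : set X, compact (W : set weak_space) & dense (linear_span W).

Definition unit_ball : set X := [set x | `|x| <= 1].

Definition homogeneous (f : X -> K) :=
  forall (c : K) x, f (c *: x) = c * f x.

Definition quasilinear (f : X -> K) :=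
  homogeneous f /\
  exists Q : K, forall x y, `|f (x + y) - f x - f y| <= Q * (`|x| + `|y|).

Definition bounded_homogeneous (f : X -> K) :=
  homogeneous f /\ exists M : K, forall x, unit_ball x -> `|f x| <= M.

Definition K_space :=
  forall f : X -> K, quasilinear f ->
    exists (l : {linear X -> K^o}) (b : X -> K),
      bounded_homogeneous b /\ forall x, f x = l x + b x.

End BanachSpaces.

Section ApproximatelyAffine.
Variables (K : numFieldType) (E : lmodType K) (D : set E) (Y : normedModType K).

(* A function on [D] is represented by a function on [E] whose values outside  *)
(* [D] are irrelevant, [D] being meant to be convex. For [t : R[i]], the       *)
(* condition [0 <= t <= 1] forces [t] to be a real of the unit interval.       *)
Definition delta_affine (delta : K) (f : E -> Y) :=
  forall x y (t : K), D x -> D y -> 0 <= t <= 1 ->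
    `|f (t *: x + (1 - t) *: y) - t *: f x - (1 - t) *: f y| <= delta.

Definition affine (f : E -> Y) := delta_affine 0 f.

Definition uniformly_bounded (f : E -> Y) :=
  exists M : K, forall x, D x -> `|f x| <= M.

Definition approximable (C delta : K) (f : E -> Y) :=
  exists2 a : E -> Y, affine a & forall x, D x -> `|f x - a x| <= C * delta.

(* The condition [0 <= C] is automatic as soon as [D] is nonempty. It makes    *)
(* the infimum in [\bar K], a partial order for [K := R[i]], the usual infimum *)
(* of a set of nonnegative reals; [+oo] is the infimum of the empty set.       *)
Definition A0_const : \bar K :=
  infimum +oo%E [set C%:E | C in [set C : K | 0 <= C /\
    forall (delta : K) (f : E -> Y), 0 <= delta ->
      uniformly_bounded f -> delta_affine delta f -> approximable C delta f]].

Definition A_const : \bar K :=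
  infimum +oo%E [set C%:E | C in [set C : K | 0 <= C /\
    forall (delta : K) (f : E -> Y), 0 <= delta ->
      delta_affine delta f -> approximable C delta f]].

End ApproximatelyAffine.

Arguments separable {K} X.
Arguments weakly_compactly_generated {K} X.
Arguments unit_ball {K} X.
Arguments K_space {K} X.
Arguments A0_const {K E} D Y.
Arguments A_const {K E} D Y.

(* Main.v *)
Require Import Defs.
From HB Require Import structures.
From mathcomp Require Import all_boot all_order all_algebra.
From mathcomp Require Import all_classical all_reals all_analysis.
From mathcomp Require Import ring lra wochoice.

Set Implicit Arguments.
Unset Strict Implicit.
Unset Printing Implicit Defensive.

Import Order.TTheory GRing.Theory Num.Theory.
Import numFieldNormedType.Exports.

Local Open Scope classical_set_scope.
Local Open Scope ring_scope.

(** Approximating a function into null sequences means approximating its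
  coordinates by affine functions that again converge to zero at each point.

  Bounded functions. A nearly affine scalar function on the ball is close to the
  real part of a quasilinear function ([homogenize]), and in a K-space quasilinear
  functions are close to linear ones with a constant depending only on the
  constant of quasilinearity ([K_space_uniform]). This gives functionals
  approximating the coordinates, with an error independent of the coordinate, but
  they need not converge to zero. They are bounded because the given function is
  bounded, and their cluster points are as small as the error. As in the proof
  of Sobczyk's theorem, subtracting from each functional a nearby cluster point
  yields a sequence converging to zero ([cluster_correction]). For separable
  spaces this uses a metric on the dual ball. In a weakly compactly generated
  space it works because a functional in the closure of a sequence is determined
  by its values on a suitable countable set of points ([determined_eq0]).

  Unbounded functions. A bounded linear map from X to the quotient of the bounded
  sequences by the null sequences has a bounded representative and a linear one,
  whose difference is a nearly affine map into the null sequences. If this were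
  close to an affine map, the map to the quotient would lift to a bounded sequence
  of functionals. By the same
  determination principle, a map with a lift has separable range. A map with
  nonseparable range is obtained from an uncountable family of functionals
  that at each point are small up to finitely many ([null_family]), sent to the
  indicator functions of an almost disjoint family of sets of natural numbers, the
  branches of the binary tree. The family is chosen by transfinite recursion: each
  functional vanishes on the points that determine the limits of the earlier ones,
  so that all limits of the family vanish. *)

(** * Real and complex scalars together *)

(** The two scalar fields are handled at once: [imu] is [0] when [K] is [R] and
  the imaginary unit when [K] is [R[i]], and in both cases a scalar is
  recovered by [re_decomp] from two real numbers. As the order of [K] is only
  partial, estimates are carried out in [R], on real parts and on the real-valued
  norm [nr] below. *)
Record real_form (R : realType) (K : numFieldType) := RealForm {
  emb : {rmorphism R -> K};
  re : K -> R;
  imu : K;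
  ler_emb : forall a b, (emb a <= emb b) = (a <= b);
  re_is_additive : forall z w, re (z - w) = re z - re w;
  re_embM : forall a z, re (emb a * z) = a * re z;
  re_emb : forall a, re (emb a) = a;
  re_imu_emb : forall a, re (imu * emb a) = 0;
  imu_cases : imu = 0 \/ imu * imu = -1;
  norm_imu_le1 : `|imu| <= 1;
  re_decomp : forall z, z = emb (re z) - imu * emb (re (imu * z));
  emb_norm_re : forall z, emb `|re z| <= `|z|;
  emb_re_ge0 : forall z, 0 <= z -> emb (re z) = z
}.

Section Instances.
Variable R : realType.

Lemma real_form_real : real_form R R.
Proof.
refine (@RealForm R R idfun id 0 _ _ _ _ _ _ _ _ _ _) => //.
- by move=> a; rewrite mul0r.
- by left.
- by rewrite normr0 ler01.
- by move=> z; rewrite !mul0r subr0.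
Qed.

Lemma real_form_complex : real_form R R[i].
Proof.
refine (@RealForm R R[i] (real_complex R) (@complex.Re R) ('i%C : R[i])
  _ _ _ _ _ _ _ _ _ _).
- by move=> a b; rewrite lecR.
- by move=> [a b] [c d].
- by move=> a [b c] /=; rewrite mul0r subr0.
- by [].
- by move=> a /=; rewrite !mul0r mul1r subr0.
- by right; rewrite -expr2 sqr_i.
- by rewrite normc_def /= expr0n /= add0r expr1n sqrtr1.
- move=> [a b]; apply/eqP; rewrite eq_complex /=.
  rewrite !(mul0r, mul1r, mulr0, subr0, add0r, sub0r, addr0, oppr0, opprK).
  by rewrite !eqxx.
- by move=> z; exact: normc_ge_Re.
- by move=> z z0; apply: RRe_real; rewrite realE z0.
Qed.

End Instances.

Section Norm.
Variables (R : realType) (K : numFieldType) (S : real_form R K).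
Implicit Types (a b : R) (z w : K).

Lemma re0 : re S 0 = 0.
Proof. by have := re_is_additive S 0 0; rewrite !subr0 subrr. Qed.

Lemma reB z w : re S (z - w) = re S z - re S w.
Proof. exact: re_is_additive. Qed.

Lemma reN z : re S (- z) = - re S z.
Proof. by rewrite -sub0r reB re0 sub0r. Qed.

Lemma reD z w : re S (z + w) = re S z + re S w.
Proof. by rewrite -{1}[w]opprK reB reN opprK. Qed.

Definition nr (V : normedZmodType K) (x : V) : R := re S `|x|.

Section NormedZmodule.
Variable V : normedZmodType K.
Implicit Types x y : V.

Lemma emb_nr x : emb S (nr x) = `|x|.
Proof. by rewrite /nr emb_re_ge0. Qed.

Lemma nr_le x a : (`|x| <= emb S a) = (nr x <= a).
Proof. by rewrite -emb_nr ler_emb. Qed.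

Lemma nr_ge0 x : 0 <= nr x.
Proof. by rewrite -(ler_emb S) rmorph0 emb_nr. Qed.

Lemma nr0 : nr (0 : V) = 0.
Proof. by rewrite /nr normr0 re0. Qed.

Lemma nr_eq0 x : (nr x == 0) = (x == 0).
Proof.
apply/eqP/eqP => [x0|->]; last exact: nr0.
by apply/eqP; rewrite -normr_eq0 -emb_nr x0 rmorph0.
Qed.

Lemma nr_gt0 x : (0 < nr x) = (x != 0).
Proof. by rewrite lt0r nr_ge0 nr_eq0 andbT. Qed.

Lemma nrN x : nr (- x) = nr x.
Proof. by rewrite /nr normrN. Qed.

Lemma nrC x y : nr (x - y) = nr (y - x).
Proof. by rewrite -opprB nrN. Qed.

Lemma nrD x y : nr (x + y) <= nr x + nr y.
Proof. by rewrite -(ler_emb S) rmorphD /= !emb_nr ler_normD. Qed.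

Lemma nrB x y : nr (x - y) <= nr x + nr y.
Proof. by rewrite (le_trans (nrD _ _))// nrN. Qed.

End NormedZmodule.

Lemma nrZ (V : normedModType K) z (x : V) : nr (z *: x) = nr z * nr x.
Proof. by rewrite /nr normrZ -{1}(emb_nr z) re_embM. Qed.

Lemma nrM z w : nr (z * w) = nr z * nr w.
Proof. by rewrite /nr normrM -{1}(emb_nr z) re_embM. Qed.

Lemma nr1 : nr (1 : K) = 1.
Proof. by rewrite /nr normr1 -(rmorph1 (emb S)) re_emb. Qed.

Lemma nr_emb_ge0 a : 0 <= a -> nr (emb S a) = a.
Proof.
by move=> a0; rewrite /nr ger0_norm ?re_emb// -(rmorph0 (emb S)) ler_emb.
Qed.

Lemma nr_emb a : nr (emb S a) = `|a|.
Proof.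
have [a0|a0] := leP 0 a; first by rewrite nr_emb_ge0// ger0_norm.
by rewrite -nrN -rmorphN ltr0_norm// nr_emb_ge0// oppr_ge0 ltW.
Qed.

Lemma nr_imu : nr (imu S) <= 1.
Proof. by rewrite -(ler_emb S) emb_nr rmorph1 norm_imu_le1. Qed.

Lemma norm_re_le z : `|re S z| <= nr z.
Proof. by rewrite -(ler_emb S) emb_nr emb_norm_re. Qed.

Lemma nr_imuM z : nr (imu S * z) <= nr z.
Proof. by rewrite nrM ler_piMl ?nr_ge0 ?nr_imu. Qed.

Lemma nr_decomp z : nr z <= `|re S z| + `|re S (imu S * z)|.
Proof.
rewrite {1}(re_decomp S z) (le_trans (nrB _ _))// nr_emb lerD2l.
by rewrite (le_trans (nr_imuM _))// nr_emb.
Qed.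

Lemma emb_inj : injective (emb S).
Proof. exact: fmorph_inj. Qed.

Lemma ltr_emb a b : (emb S a < emb S b) = (a < b).
Proof. by rewrite !lt_neqAle ler_emb (inj_eq emb_inj). Qed.

Lemma emb_gt0 a : (0 < emb S a) = (0 < a).
Proof. by rewrite -(rmorph0 (emb S)) ltr_emb. Qed.

Lemma emb_ge0 a : (0 <= emb S a) = (0 <= a).
Proof. by rewrite -(rmorph0 (emb S)) ler_emb. Qed.

Lemma nr_lt (V : normedZmodType K) (x : V) a : (`|x| < emb S a) = (nr x < a).
Proof. by rewrite -emb_nr ltr_emb. Qed.

End Norm.

(** * Limits along ultrafilters *)

(** Limits along ultrafilters replace weak-star cluster points: every bounded
  family of functionals has one, and it is again a bounded functional. *)
Section UltraLimits.
Variables (R : realType) (K : numFieldType) (S : real_form R K).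
Variables (I : Type) (U : set_system I).
Hypothesis UU : UltraFilter U.

Definition ulim_to (u : I -> K) (l : K) :=
  forall e : R, 0 < e -> U [set i | nr S (u i - l) < e].

Lemma ulim_real (r : I -> R) (M : R) : U [set i | `|r i| <= M] ->
  exists l : R, forall e, 0 < e -> U [set i | `|r i - l| < e].
Proof.
move=> UM.
have FF : ProperFilter (r @ U) by apply: fmap_proper_filter; case: UU.
have [|l [_ cl]] := @segment_compact R (- M) M (r @ U) FF.
  rewrite /fmap /=.
  by apply: filterS UM => i iM; rewrite /= in_itv /= -ler_norml.
exists l => e e0; set A := [set i | _].
have [//|UA] := in_ultra_setVsetC A UU.
have [//||y [/= yA ye]] := cl [set y | ~ (`|y - l| < e)] (ball l e).
  exact: nbhsx_ballx.
by exfalso; apply: yA; move: ye; rewrite /ball /= distrC.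
Qed.

Lemma ulim_ex (u : I -> K) (M : R) : U [set i | nr S (u i) <= M] ->
  exists l, ulim_to u l.
Proof.
move=> UM; have PU : ProperFilter U by case: UU.
have [|a ua] := @ulim_real (fun i => re S (u i)) M.
  by apply: filterS UM => i; apply: le_trans; exact: norm_re_le.
have [|b ub] := @ulim_real (fun i => re S (imu S * u i)) M.
  apply: filterS UM => i; apply: le_trans.
  by rewrite (le_trans (norm_re_le _ _)) ?nr_imuM.
exists (emb S a - imu S * emb S b) => e e0.
have e20 : 0 < e / 2 by rewrite divr_gt0.
apply: filterS (filterI (ua _ e20) (ub _ e20)) => i [/= ai bi].
rewrite [X in X - _](re_decomp S).
set p := emb _ _; set q := emb S (re _ (imu S * _)).
have -> : p - imu S * q - (emb S a - imu S * emb S b) =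
  (p - emb S a) - imu S * (q - emb S b) by ring.
rewrite -!rmorphB (le_lt_trans (nrB _ _ _))// nr_emb.
rewrite [ltRHS](splitr e) ltr_leD//.
  rewrite (le_trans (nr_imuM _ _))// nr_emb; exact: ltW.
Qed.

Lemma ulim_le (u : I -> K) l c : ulim_to u l ->
  U [set i | nr S (u i) <= c] -> nr S l <= c.
Proof.
move=> ul uc; have PU : ProperFilter U by case: UU.
apply/ler_addgt0Pr => e e0.
have [i [/= ic ie]] := filter_ex (filterI uc (ul e e0)).
have -> : l = u i - (u i - l) by ring.
by rewrite (le_trans (nrB _ _ _))// lerD// ltW.
Qed.

Lemma ulim_ge (u : I -> K) l c : ulim_to u l ->
  U [set i | c <= nr S (u i)] -> c <= nr S l.
Proof.
move=> ul uc; have PU : ProperFilter U by case: UU.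
apply/ler_addgt0Pr => e e0.
have [i [/= ic ie]] := filter_ex (filterI uc (ul e e0)).
rewrite (le_trans ic)//.
have -> : u i = l + (u i - l) by ring.
by rewrite (le_trans (nrD _ _ _))// lerD2l ltW.
Qed.

Lemma ulim_lin (u v : I -> K) l m a : ulim_to u l -> ulim_to v m ->
  ulim_to (fun i => a * u i + v i) (a * l + m).
Proof.
move=> ul vm e e0; have PU : ProperFilter U by case: UU.
pose d := e / (nr S a + 2).
have a2 : 0 < nr S a + 2 by rewrite ltr_wpDl ?nr_ge0.
have d0 : 0 < d by rewrite divr_gt0.
apply: filterS (filterI (ul d d0) (vm d d0)) => i [/= ai bi].
have -> : a * u i + v i - (a * l + m) = a * (u i - l) + (v i - m) by ring.
rewrite (le_lt_trans (nrD _ _ _))// nrM.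
have -> : e = (nr S a + 2) * d by rewrite /d mulrC divfK// gt_eqF.
rewrite mulrDl ler_ltD// ?ler_wpM2l ?nr_ge0 ?ltW//.
by lra.
Qed.

Lemma ulim_cst c : ulim_to (fun=> c) c.
Proof.
move=> e e0; have PU : ProperFilter U by case: UU.
by apply: filterS filterT => i _ /=; rewrite subrr nr0.
Qed.

Lemma ulim_near (u v : I -> K) l : ulim_to u l ->
  (forall e : R, 0 < e -> U [set i | nr S (u i - v i) < e]) -> ulim_to v l.
Proof.
move=> ul uv e e0; have PU : ProperFilter U by case: UU.
have e20 : 0 < e / 2 by rewrite divr_gt0.
apply: filterS (filterI (ul _ e20) (uv _ e20)) => i [/= ai bi].
have -> : v i - l = (u i - l) - (u i - v i) by ring.
by rewrite (le_lt_trans (nrB _ _ _))// [ltRHS](splitr e) ltrD.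
Qed.

Lemma ulim_unique (u : I -> K) l m : ulim_to u l -> ulim_to u m -> l = m.
Proof.
move=> ul um; apply/eqP; rewrite -subr_eq0 -(nr_eq0 S) eq_le nr_ge0 andbT.
apply/ler_addgt0Pr => e e0; rewrite add0r.
have e20 : 0 < e / 2 by rewrite divr_gt0.
have PU : ProperFilter U by case: UU.
have [i [/= li mi]] := filter_ex (filterI (ul _ e20) (um _ e20)).
have -> : l - m = (u i - m) - (u i - l) by ring.
by rewrite (le_trans (nrB _ _ _))// (splitr e) ltW// ltrD.
Qed.

Lemma ulim_eq (u v : I -> K) l m : ulim_to u l -> ulim_to v m ->
  U [set i | u i = v i] -> l = m.
Proof.
move=> ul vm uv; apply: (@ulim_unique v) => //.
apply: (ulim_near ul) => e e0; have PU : ProperFilter U by case: UU.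
by apply: filterS uv => i /= ->; rewrite subrr nr0.
Qed.

Definition ulim (u : I -> K) : K := xget 0 [set l | ulim_to u l].

Lemma ulimP (u : I -> K) (M : R) : U [set i | nr S (u i) <= M] ->
  ulim_to u (ulim u).
Proof. by move=> /ulim_ex[l ul]; apply: xgetPex; exists l. Qed.

End UltraLimits.

Lemma free_ultrafilter (I : Type) (A : set I) : infinite_set A ->
  exists U : set_system I, [/\ UltraFilter U, U A &
    forall B, finite_set B -> U (~` B)].
Proof.
move=> infA; pose F : set_system I := [set B | finite_set (A `\` B)].
have FF : ProperFilter F.
  apply: Build_ProperFilter_ex => [B FB|].
    have [//|nB] := pselect (exists x, B x).
    exfalso; apply: infA; apply: sub_finite_set FB => x Ax; split => // Bx.
    by apply: nB; exists x.
  split=> [|B C FB FC|B C BC FB].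
  - by rewrite /F /= setDT; exact: finite_set0.
  - by rewrite /F /= setDIr finite_setU.
  - by apply: sub_finite_set FB => x [Ax nC]; split => // /BC.
have [U [UU FU]] := ultraFilterLemma FF.
exists U; split => // [|B finB]; apply: FU; rewrite /F /=.
  by rewrite setDv; exact: finite_set0.
by apply: sub_finite_set finB => x [_ /contrapT].
Qed.

(** * Linear lifts modulo a submodule *)

Section LinearLifting.
Variables (K : fieldType) (X V : lmodType K) (Z : set V) (G : X -> V).
Hypothesis ZD : forall a u v, Z u -> Z v -> Z (a *: u + v).
Hypothesis GZ : forall a x y, Z (G (a *: x + y) - (a *: G x + G y)).

(* The partial linear lifts of [G], as graphs. *)
Let P : set (set (X * V)) := [set g |
  [/\ forall a p q, g p -> g q -> g (a *: p + q),
      forall v, g (0, v) -> v = 0 & forall x v, g (x, v) -> Z (G x - v)]].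

(** Zorn's lemma extends a partial linear lift one vector at a time, so no basis
  is needed. The lemma serves to normalize all quasilinear functions at once, and
  to turn a map that is linear only modulo null sequences into a linear one. *)
Lemma linear_lift : exists L : X -> V,
  (forall a x y, L (a *: x + y) = a *: L x + L y) /\ forall x, Z (G x - L x).
Proof.
have [|g [[glin g0 gZ] gmax]] := @Zorn_bigcup (X * V)%type P.
  move=> F FP tot; split.
  - move=> a p q [g1 F1 g1p] [g2 F2 g2q].
    have [s|s] := tot _ _ F1 F2.
      by exists g2 => //; have [+ _ _] := FP _ F2; apply => //; exact: s.
    by exists g1 => //; have [+ _ _] := FP _ F1; apply => //; exact: s.
  - by move=> v [g1 F1]; have [_ + _] := FP _ F1; apply.
  - by move=> x v [g1 F1]; have [_ _ +] := FP _ F1; apply.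
have G0 : Z (G 0).
  have := GZ (-1) 0 0; rewrite scaleN1r addNr scaleN1r addNr subr0; exact.
have g00 : g (0, 0).
  apply: contrapT => n0; apply: (gmax [set (0, 0)]).
    split=> [p gp|/(_ (0, 0) erefl)//].
    have := glin (-1) _ _ gp gp; rewrite scaleN1r addNr => g0'.
    by exfalso; apply: n0.
  split=> [a p q -> ->|v [] //|x v [-> ->]].
    by rewrite scaler0 addr0.
  by rewrite subr0.
have gtot x : exists v, g (x, v).
  apply: contrapT => nx.
  pose h : set (X * V) := [set p | exists a q, g q /\ p = q + a *: (x, G x)].
  apply: (gmax h).
    split=> [p gp|/(_ (x, G x))gh].
      by exists 0, p; rewrite scale0r addr0.
    apply: nx; exists (G x); apply: gh.
    by exists 1, (0, 0); rewrite scale1r add0r.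
  split.
  - move=> c _ _ [a [p [gp ->]]] [b [q [gq ->]]].
    exists (c * a + b), (c *: p + q); split; first exact: glin.
    by rewrite scalerDr scalerDl -scalerA !addrA; congr (_ + _);
      rewrite -!addrA; congr (_ + _); rewrite addrC.
  - move=> v [a [[y w] [gq]]] [y0 ->].
    have [a0|a0] := eqVneq a 0.
      move: gq y0; rewrite a0 !scale0r !addr0 => gq y0.
      by apply: g0; rewrite [X in g (X, _)]y0.
    exfalso; apply: nx; exists (- a^-1 *: w).
    suff -> : (x, - a^-1 *: w) = (- a^-1) *: (y, w) + (0, 0) by exact: glin.
    rewrite addr0; congr (_, _).
    apply: (scalerI a0); rewrite scalerA mulrN divff// scaleN1r.
    by apply/eqP; rewrite -addr_eq0 addrC -y0.
  - move=> y v [a [[z w] [gq]]] [-> ->].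
    have := ZD 1 (gZ _ _ gq) (GZ a x z).
    rewrite scale1r (addrC z) => Zs.
    suff -> : G (a *: x + z) - (w + a *: G x) =
       G z - w + (G (a *: x + z) - (a *: G x + G z)) by [].
    rewrite (addrC (a *: G x)) !opprD !addrA (addrC (G z)).
    by rewrite (addrAC (- w + G z)) addrK (addrC (- w)).
exists (fun x => xget 0 [set v | g (x, v)]).
have gL x : g (x, xget 0 [set v | g (x, v)]) by have := gtot x; apply: xgetPex.
have guniq x v w : g (x, v) -> g (x, w) -> v = w.
  move=> gv gw; have : g (-1 *: x + x, -1 *: v + w) := glin (-1) _ _ gv gw.
  rewrite !scaleN1r addNr => /g0/eqP.
  by rewrite addrC subr_eq0 => /eqP.
split=> [a x y|x]; last exact: gZ.
apply: (guniq (a *: x + y)) => //.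
exact: glin (gL x) (gL y).
Qed.

End LinearLifting.

(** * Functionals on a weakly compactly generated space *)

Section Functionals.
Variables (R : realType) (K : numFieldType) (S : real_form R K).
Variable (X : normedModType K).
Local Notation nr := (nr S).
Implicit Types (phi theta : X -> K) (x y : X).

Definition klin phi := forall a x y, phi (a *: x + y) = a * phi x + phi y.

Section Klin.
Variables (phi : X -> K) (lphi : klin phi).

Lemma klinD x y : phi (x + y) = phi x + phi y.
Proof. by have := lphi 1 x y; rewrite scale1r mul1r. Qed.

Lemma klin0 : phi 0 = 0.
Proof. by apply: (addrI (phi 0)); rewrite -klinD !addr0. Qed.

Lemma klinZ a x : phi (a *: x) = a * phi x.
Proof. by have := lphi a x 0; rewrite !addr0 klin0 addr0. Qed.

Lemma klinN x : phi (- x) = - phi x.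
Proof. by rewrite -scaleN1r klinZ mulN1r. Qed.

Lemma klinB x y : phi (x - y) = phi x - phi y.
Proof. by rewrite klinD klinN. Qed.

Lemma klin_sum n (c : 'I_n -> K) (w : 'I_n -> X) :
  phi (\sum_i c i *: w i) = \sum_i c i * phi (w i).
Proof.
elim/big_ind2 : _ => [|x a y b <- <-|i _]; rewrite ?klin0 ?klinD//.
by rewrite klinZ.
Qed.

End Klin.

Lemma klin_comb a phi theta : klin phi -> klin theta ->
  klin (fun x => a * phi x + theta x).
Proof. by move=> lp lt b x y; rewrite lp lt; ring. Qed.

Definition dual_bd (M : R) phi := klin phi /\ forall x, nr (phi x) <= M * nr x.

Lemma dual_bd_linear M phi : dual_bd M phi ->
  exists l : dual X, forall x, sval l x = phi x.
Proof.
move=> [lphi phiM].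
pose L : {linear X -> K^o} :=
  HB.pack (phi : X -> K^o)
    (GRing.isLinear.Build K X K^o *:%R (phi : X -> K^o) lphi).
suff Lc : continuous L by exists (exist _ L Lc).
apply: bounded_linear_continuous; apply/ex_bound.
exists (emb S `|M|); apply/nbhs_normP; exists 1 => //= x /=.
rewrite sub0r normrN => x1; rewrite nr_le (le_trans (phiM x))//.
rewrite (le_trans (ler_wpM2r (nr_ge0 _ _) (ler_norm M)))// ler_piMr//.
by rewrite -nr_le rmorph1 ltW.
Qed.

Lemma weak_nbhs M phi x e : dual_bd M phi -> 0 < e ->
  nbhs (x : weak_space X) [set y | nr (phi y - phi x) < e].
Proof.
move=> /dual_bd_linear[l lphi] e0.
have := (@cvg_sup X (dual X) (fun f : dual X =>
  Topological.class (initial_topology (sval f : X -> K^o)))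
  (nbhs (x : weak_space X)) x _).
move=> [+ _] => /(_ (@cvg_id _ _))/(_ l) H.
have -> : [set y | nr (phi y - phi x) < e] = sval l @^-1` [set z | nr (z - phi x) < e].
  by apply/funext => y /=; rewrite lphi.
apply: H.
have := @initial_continuous X K^o (sval l) x.
move=> /(_ [set z | nr (z - phi x) < e]) H2; apply: H2.
rewrite lphi /=; apply/nbhs_normP; exists (emb S e) => /=.
  by rewrite emb_gt0.
by move=> z /=; rewrite distrC nr_lt.
Qed.

Variable W : set X.
Hypothesis cW : compact (W : set (weak_space X)).
Hypothesis dW : dense (linear_span W).

Lemma weak_ulim (I : Type) (U : set_system I) (UU : UltraFilter U) (w : I -> X) :
  U [set i | W (w i)] ->
  exists2 x, W x & forall M phi, dual_bd M phi ->
    ulim_to S U (fun i => phi (w i)) (phi x).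
Proof.
move=> UW; have PU : ProperFilter U by case: UU.
have [x [Wx cx]] := cW (@fmap_proper_filter _ _ (w : I -> weak_space X) _ PU) UW.
exists x => // M phi pd e e0; set A := [set i | _].
have [//|UA] := in_ultra_setVsetC A UU.
have [//|y [/= yA ye]] := cx [set y | ~ (nr (phi y - phi x) < e)] _ _ (weak_nbhs x pd e0).
by exfalso; apply: yA.
Qed.

(** If no finite subset of [W] were a net, the sets of points far from a given
  finite subset would generate a filter, and a weak limit point in [W] of an
  ultrafilter finer than it would be close to itself and far from itself. *)
Lemma finite_net (I : eqType) (f : I -> X -> K) (M : R) (b : seq I) (e : R) :
  (forall i, i \in b -> dual_bd M (f i)) -> 0 < e ->
  exists s : seq X, (forall x, x \in s -> W x) /\
    forall w, W w -> exists2 x, x \in s & forall i, i \in b -> nr (f i w - f i x) < e.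
Proof.
move=> fb e0; apply: contrapT => nos.
pose close w x := forall i, i \in b -> nr (f i w - f i x) < e.
pose F : set_system X := [set A | exists s : seq X,
  (forall x, x \in s -> W x) /\
  forall w, W w -> (forall x, x \in s -> ~ close w x) -> A w].
have FF : ProperFilter F.
  apply: Build_ProperFilter_ex => [A [s [sW sA]]|].
    apply: contrapT => nA; apply: nos; exists s; split => // w Ww.
    apply: contrapT => nx; apply: nA; exists w; apply: sA => // x xs cx.
    by apply: nx; exists x.
  split=> [|A B [s [sW sA]] [t [tW tB]]|A B AB [s [sW sA]]].
  - by exists [::].
  - exists (s ++ t); split=> [x|w Ww wst].
      by rewrite mem_cat => /orP[/sW|/tW].
    split; [apply: sA|apply: tB] => // x xs; apply: wst;
      by rewrite mem_cat xs ?orbT.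
  - by exists s; split => // w Ww ws; apply/AB/sA.
have [U [UU FU]] := ultraFilterLemma FF.
have PU : ProperFilter U by case: UU.
have [|x Wx xlim] := @weak_ulim X U UU id.
  by apply: FU; exists [::].
have Uc : U [set w | close w x].
  rewrite /close; elim: b fb {nos close F FF FU} => [|i c IH] fb.
    by apply: filterS filterT => w _ i.
  have ci : U [set w | forall j, j \in c -> nr (f j w - f j x) < e].
    by apply: IH => j jc; apply: fb; rewrite inE jc orbT.
  have := xlim _ _ (fb i (mem_head _ _)) e e0.
  move=> /(filterI ci); apply: filterS => w [wc wi] j.
  by rewrite inE => /predU1P[->//|/wc].
have Un : U [set w | ~ close w x].
  apply: FU; exists [:: x]; split=> [y|w Ww]; first by rewrite inE => /eqP->.
  by apply; rewrite mem_head.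
by have [w [/= wc]] := filter_ex (filterI Uc Un); apply.
Qed.

Lemma dual_eq0 M theta : dual_bd M theta -> (forall w, W w -> theta w = 0) ->
  forall x, theta x = 0.
Proof.
move=> [ltheta tM] tW x; apply/eqP; rewrite -(nr_eq0 S) eq_le nr_ge0 andbT.
apply/ler_addgt0Pr => e e0; rewrite add0r.
pose d := e / (`|M| + 1).
have M1 : 0 < `|M| + 1 by rewrite ltr_wpDl.
have d0 : 0 < d by rewrite divr_gt0.
have ed0 : 0 < emb S d by rewrite emb_gt0.
have [||v [/= xv [n [c [w [wW vE]]]]]] := dW (O := ball x (emb S d)).
- by exists x; exact: ballxx.
- exact: ball_open.
have tv : theta v = 0.
  by rewrite vE klin_sum// big1// => i _; rewrite tW ?mulr0.
have -> : theta x = theta (x - v) by rewrite klinB// tv subr0.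
rewrite (le_trans (tM _))// (le_trans (ler_wpM2r (nr_ge0 _ _) (ler_norm M)))//.
have : nr (x - v) <= d.
  by rewrite -nr_le; move: xv; rewrite -ball_normE /= => /ltW.
move=> /(ler_wpM2l (normr_ge0 M))/le_trans; apply.
rewrite /d mulrA ler_pdivrMr// mulrC ler_pM2l//.
by rewrite lerDl.
Qed.

(** This replaces the metrizability of weak-star separable subsets of the dual of
  a weakly compactly generated space. Points of [D] on which the [f i] are
  close to their values at [w] cluster weakly to some [z] in [W]. The [f i],
  hence also [theta], take the same values at [w] and [z], and [theta] vanishes
  at [z] because it vanishes on [D]. *)
Lemma determined_eq0 (I : eqType) (f : I -> X -> K) (A : set I) (D : set X)
    (M N : R) theta :
  (forall i, A i -> dual_bd M (f i)) -> dual_bd N theta -> D `<=` W ->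
  (forall w (b : seq I) (e : R), W w -> (forall i, i \in b -> A i) -> 0 < e ->
    exists2 d, D d & forall i, i \in b -> nr (f i w - f i d) < e) ->
  (forall w z, (forall i, A i -> f i w = f i z) -> theta w = theta z) ->
  (forall d, D d -> theta d = 0) ->
  forall x, theta x = 0.
Proof.
move=> fM tN DW net det tD; apply: (dual_eq0 tN) => w Ww.
pose F : set_system X := [set B | exists (b : seq I) (e : R),
  [/\ forall i, i \in b -> A i, 0 < e &
  forall d, D d -> (forall i, i \in b -> nr (f i w - f i d) < e) -> B d]].
have FF : ProperFilter F.
  apply: Build_ProperFilter_ex => [B [b [e [bA e0 bB]]]|].
    by have [d Dd db] := net w b e Ww bA e0; exists d; exact: bB.
  split=> [|B C [b [e [bA e0 bB]]] [c [g [cA g0 cC]]]|B C BC [b [e [bA e0 bB]]]].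
  - by exists [::], 1.
  - exists (b ++ c), (Num.min e g); split=> [i||d Dd bc].
    + by rewrite mem_cat => /orP[/bA|/cA].
    + by rewrite lt_min e0.
    + split; [apply: bB|apply: cC] => // i ib.
        by have := bc i; rewrite mem_cat ib => /(_ isT); rewrite lt_min => /andP[].
      by have := bc i; rewrite mem_cat ib orbT => /(_ isT); rewrite lt_min => /andP[].
  - by exists b, e; split => // d Dd db; apply/BC/bB.
have [U [UU FU]] := ultraFilterLemma FF.
have PU : ProperFilter U by case: UU.
have UD : U D by apply: FU; exists [::], 1.
have [|z Wz zlim] := @weak_ulim X U UU id; first by apply: filterS UD.
rewrite (det w z) => [|i Ai].
  apply: (ulim_eq UU (zlim _ _ tN) (ulim_cst S UU 0)).
  by apply: filterS UD => d /= /tD.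
have wi : ulim_to S U (fun d => f i d) (f i w).
  apply: (ulim_near UU (ulim_cst S UU _)) => e e0; apply: FU.
  exists [:: i], e; split => // [j|d Dd]; first by rewrite inE => /eqP->.
  by apply; rewrite mem_head.
exact: (ulim_unique UU wi (zlim _ _ (fM i Ai))).
Qed.

End Functionals.

Lemma invS_lt (R : realType) (e : R) : 0 < e ->
  exists n : nat, forall k, (n <= k)%N -> k.+1%:R^-1 < e.
Proof.
move=> e0; exists (Num.truncn e^-1) => k nk.
rewrite invf_plt ?posrE//; apply: lt_le_trans (truncnS_gt _) _.
by rewrite ler_nat ltnS.
Qed.

Lemma ltn_seq_bound (b : seq nat) : exists N, forall i, i \in b -> (i < N)%N.
Proof.
by exists (\max_(i <- b) i).+1 => i ib; rewrite ltnS leq_bigmax_seq.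
Qed.

(** * Correcting a sequence of functionals by cluster functionals *)

Section ClusterFunctionals.
Variables (R : realType) (K : numFieldType) (S : real_form R K).
Variable (X : normedModType K).
Local Notation nr := (nr S).

Lemma ulim_klin (I : Type) (U : set_system I) (f : I -> X -> K) (theta : X -> K) :
  UltraFilter U -> (forall i, klin (f i)) ->
  (forall x, ulim_to S U (f ^~ x) (theta x)) -> klin theta.
Proof.
move=> UU fl ft a x y.
apply: (ulim_unique UU (ft _)).
have -> : f ^~ (a *: x + y) = fun i => a * f i x + f i y.
  by apply/funext => i; rewrite fl.
exact: ulim_lin.
Qed.

Lemma ulim_dual_bd (I : Type) (U : set_system I) (f : I -> X -> K)
    (M : R) (theta : X -> K) :
  UltraFilter U -> (forall i, dual_bd S M (f i)) ->
  (forall x, ulim_to S U (f ^~ x) (theta x)) -> dual_bd S M theta.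
Proof.
move=> UU fM ft; split=> [|x].
  by apply: (ulim_klin UU _ ft) => i; have [] := fM i.
have PU : ProperFilter U by case: UU.
apply: (ulim_le UU (ft x)); apply: filterS filterT => i _.
by have [_] := fM i; apply.
Qed.

Lemma dual_bd_ulim (I : Type) (U : set_system I) (f : I -> X -> K) (M : R) :
  UltraFilter U -> (forall i, dual_bd S M (f i)) ->
  exists theta, forall x, ulim_to S U (f ^~ x) (theta x).
Proof.
move=> UU fM; exists (fun x => ulim S U (f ^~ x)) => x.
have PU : ProperFilter U by case: UU.
apply: (@ulimP _ _ _ _ _ _ _ (M * nr x)); apply: filterS filterT => i _.
by have [_] := fM i; apply.
Qed.

Variable W : set X.
Hypothesis cW : compact (W : set (weak_space X)).
Hypothesis dW : dense (linear_span W).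

Lemma exhausting_nets (f : nat -> X -> K) (M : R) :
  (forall n, dual_bd S M (f n)) -> exists net : nat -> seq X,
    (forall k x, x \in net k -> W x) /\
    forall w (b : seq nat) (e : R), W w -> 0 < e ->
      exists2 x, (exists k, x \in net k) &
        forall i, i \in b -> nr (f i w - f i x) < e.
Proof.
move=> fM; have /choice[net netP] : forall k, exists s : seq X,
    (forall x, x \in s -> W x) /\ forall w, W w -> exists2 x, x \in s &
      forall i, i \in iota 0 k -> nr (f i w - f i x) < k.+1%:R^-1.
  by move=> k; apply: (finite_net (S := S) cW (f := f) (M := M)).
exists net; split=> [k|w b e Ww e0]; first exact: (netP k).1.
have [N bN] := ltn_seq_bound b; have [n ne] := invS_lt e0.
have [_ /(_ w Ww)[x xk xw]] := netP (maxn N n).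
exists x => [|j jb]; first by exists (maxn N n).
apply: lt_trans (xw j _) _.
  by rewrite mem_iota /= add0n (leq_trans (bN j jb))// leq_maxl.
by apply: ne; rewrite leq_maxr.
Qed.

Variables (l : nat -> X -> K) (M : R).
Hypothesis lM : forall n, dual_bd S M (l n).

Definition cluster_functional (psi : X -> K) := exists U : set_system nat,
  [/\ UltraFilter U, forall B, finite_set B -> U (~` B) &
     forall x, ulim_to S U (l ^~ x) (psi x)].

Lemma cluster_functional_dual psi : cluster_functional psi -> dual_bd S M psi.
Proof. by move=> [U [UU _ lim]]; exact: (ulim_dual_bd UU lM lim). Qed.

(** For each [k] all but finitely many [l n] are [close k] to a cluster
  functional, since a cluster functional of the others would be [close k] to
  infinitely many of them. Let [b n] be a cluster functional which is close to
  [l n] at the largest possible level not exceeding [n]. If [l n - b n] did not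
  tend to zero at [x], its limit along some free ultrafilter would be nonzero at
  [x], although it vanishes on all nets and is thus zero by [determined_eq0]. *)
Lemma cluster_correction : exists b : nat -> X -> K,
  (forall n, cluster_functional (b n)) /\
  forall x e, 0 < e -> finite_set [set n | e <= nr (l n x - b n x)].
Proof.
have [net [netW netP]] := exhausting_nets lM.
(* Being [close k] is being [1 / k.+1]-close for the first [k] nets; it plays the
   role of a distance at most [1 / k.+1] in a metric. *)
pose pts k := flatten [seq net j | j <- iota 0 k].
have ptsS j k x : (j < k)%N -> x \in net j -> x \in pts k.
  by move=> jk xj; apply/flatten_mapP; exists j; rewrite ?mem_iota.
pose close k n psi := forall x, x \in pts k -> nr (l n x - psi x) < k.+1%:R^-1.
have closeW j k n psi : (j <= k)%N -> close k n psi -> close j n psi.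
  move=> jk ck x /flatten_mapP[i0]; rewrite mem_iota add0n => /= ij xi.
  apply: lt_le_trans (ck x _) _; first by apply: (ptsS i0) xi; exact: leq_trans ij jk.
  by rewrite lef_pV2 ?posrE// ler_nat ltnS.
have cl_ex (A : set nat) : infinite_set A -> exists psi U,
    [/\ UltraFilter U, U A, forall B, finite_set B -> U (~` B) &
     forall x, ulim_to S U (l ^~ x) (psi x)].
  move=> /free_ultrafilter[U [UU UA Uf]].
  by have [psi lim] := dual_bd_ulim UU lM; exists psi, U.
pose bad k := [set n | ~ exists2 psi, cluster_functional psi & close k n psi].
have bad_fin k : finite_set (bad k).
  apply: contrapT => /cl_ex[psi [U [UU UB Uf lim]]].
  have PU : ProperFilter U by case: UU.
  suff Uc : U [set n | close k n psi].
    have [n [nb nc]] := filter_ex (filterI UB Uc).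
    by apply: nb; exists psi => //; exists U.
  rewrite /close; elim: (pts k) => [|x s IH].
    by apply: filterS filterT => n _ x.
  have k0 : (0 : R) < k.+1%:R^-1 by rewrite invr_gt0.
  have := lim x _ k0; move=> /(filterI IH); apply: filterS => n [ns nx] y.
  by rewrite inE => /predU1P[->|/ns].
have /choice[b bP] : forall n, exists psi, cluster_functional psi /\
    forall k, (k <= n)%N -> ~ bad k n -> close k n psi.
  move=> n; pose P k := (k <= n)%N && `[< ~ bad k n >].
  have exP : exists k, P k.
    exists 0%N; rewrite /P leq0n; apply/asboolP => /=; apply.
    have [psi [U [UU _ Uf lim]]] := cl_ex _ infinite_nat.
    by exists psi; [exists U|move=> x].
  have leP k : P k -> (k <= n)%N by move=> /andP[].
  case: (ex_maxnP exP leP) => k /andP[kn /asboolP/contrapT[psi psic psik]] kmax.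
  exists psi; split => // j jn nbad; apply: closeW psik; apply: kmax.
  by rewrite /P jn; exact/asboolP.
exists b; split=> [n|x e e0]; first by case: (bP n).
apply: contrapT => /free_ultrafilter[U [UU Ue Uf]].
have PU : ProperFilter U by case: UU.
pose g n y := -1 * b n y + l n y.
have gM n : dual_bd S (M + M) (g n).
  have [bl bM] := cluster_functional_dual (bP n).1; have [ll llM] := lM n.
  split; first exact: klin_comb.
  move=> y; rewrite /g mulN1r addrC (le_trans (nrB _ _ _))// mulrDl.
  by rewrite lerD.
have [theta lim] := dual_bd_ulim UU gM.
suff t0 : theta x = 0.
  have : e <= nr (theta x).
    apply: (ulim_ge UU (lim x)); apply: filterS Ue => n /=.
    by rewrite /g mulN1r addrC.
  by rewrite t0 nr0 leNgt e0.
apply: (determined_eq0 (S := S) cW dW (f := l) (A := setT)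
  (D := [set x | exists k, x \in net k]) (M := M) (N := M + M)).
- by [].
- exact: (ulim_dual_bd UU gM lim).
- by move=> d [k dk]; exact: netW dk.
- by move=> w c r Ww _ r0; exact: netP.
- move=> w z wz; apply: (ulim_eq UU (lim w) (lim z)).
  apply: filterS filterT => n _ /=; rewrite /g wz//; congr (_ * _ + _).
  have [V [VV _ limb]] := (bP n).1.
  apply: (ulim_eq VV (limb w) (limb z)); have PV : ProperFilter V by case: VV.
  by apply: filterS filterT => i _ /=; exact: wz.
- move=> d [k dk]; apply: (ulim_unique UU (lim d)) => r r0.
  have [n nr0] := invS_lt r0; pose j := maxn k.+1 n.
  have jfin : finite_set (bad j `|` `I_j).
    by rewrite finite_setU; split => //; exact: finite_II.
  apply: filterS (Uf _ jfin) => i /= ij.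
  rewrite subr0 /g mulN1r addrC.
  have [ji nbad] : (j <= i)%N /\ ~ bad j i.
    split; last by move=> ?; apply: ij; left.
    by rewrite leqNgt; apply/negP => ?; apply: ij; right.
  have := (bP i).2 _ ji nbad d; move=> /(_ _)/lt_trans; apply.
    by apply: ptsS dk; rewrite leq_maxl.
  by apply: nr0; rewrite leq_maxr.
Qed.

End ClusterFunctionals.

(** * From nearly affine to quasilinear functions *)

Section Homogenization.
Variables (R : realType) (K : numFieldType) (S : real_form R K).
Variable (X : normedModType K).
Local Notation nr := (nr S).
Local Notation emb := (emb S).
Local Notation re := (re S).
Local Notation imu := (imu S).

Definition real_delta_affine (d : R) (r : X -> R) :=
  forall x y (t : R), nr x <= 1 -> nr y <= 1 -> 0 <= t <= 1 ->
    `|r (emb t *: x + emb (1 - t) *: y) - t * r x - (1 - t) * r y| <= d.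

(* The numerical constants below have no significance. *)
Variables (d : R) (r : X -> R).
Hypothesis rd : real_delta_affine d r.
Hypothesis r0 : r 0 = 0.

Let nr00 : nr (0 : X) <= 1.
Proof. by rewrite nr0 ler01. Qed.

Let d0 : 0 <= d.
Proof. by apply: le_trans (rd nr00 nr00 (t := 0) _); rewrite ?lexx ?ler01. Qed.

Let half01 : 0 <= (1 / 2 : R) <= 1.
Proof. by apply/andP; split; lra. Qed.

Let nrZemb (t : R) (x : X) : nr (emb t *: x) = `|t| * nr x.
Proof. by rewrite nrZ nr_emb. Qed.

Let nrZi (x : X) c : nr x <= c -> nr (imu *: x) <= c.
Proof.
move=> xc; rewrite nrZ (le_trans _ xc)// ler_piMl ?nr_ge0//.
exact: nr_imu.
Qed.

Let r_scale (t : R) (x : X) : nr x <= 1 -> 0 <= t <= 1 -> `|r (emb t *: x) - t * r x| <= d.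
Proof.
by move=> x1 t1; have := rd x1 nr00 t1; rewrite scaler0 addr0 r0 mulr0 subr0.
Qed.

Let r_opp (x : X) : nr x <= 1 -> `|r (- x) + r x| <= 2 * d.
Proof.
move=> x1; have x1' : nr (- x) <= 1 by rewrite nrN.
have := rd x1 x1' (t := 1 / 2); have -> : 1 - 1 / 2 = 1 / 2 :> R by lra.
rewrite scalerN subrr r0 => /(_ _)H; have {H} := H half01.
by rewrite !ler_norml; lra.
Qed.

Let r_real (t : R) (x : X) : nr x <= 1 -> `|t| <= 1 -> `|r (emb t *: x) - t * r x| <= 3 * d.
Proof.
move=> x1 t1; have [t0|t0] := leP 0 t.
  have : 0 <= t <= 1 by rewrite t0 (le_trans (ler_norm _)).
  by move=> /(r_scale x1) /le_trans; apply; rewrite -subr_ge0; have := d0; lra.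
have x1' : nr (- x) <= 1 by rewrite nrN.
have t1' : 0 <= - t <= 1 by move: t1; rewrite ler_norml; lra.
have := r_scale x1' t1'; rewrite rmorphN scalerN scaleNr opprK mulNr opprK.
have := r_opp x1.
have -> : r (emb t *: x) - t * r x =
  (r (emb t *: x) + t * r (- x)) - t * (r (- x) + r x) by ring.
move=> H1 H2; rewrite (le_trans (ler_normB _ _))// normrM.
have := ler_pM (normr_ge0 _) (normr_ge0 _) t1 H1.
by move: H2; lra.
Qed.

Let r_add x y : nr x <= 1 / 2 -> nr y <= 1 / 2 ->
  `|r (x + y) - r x - r y| <= 3 * d.
Proof.
move=> x2 y2.
have h2 : emb (1 / 2) * emb 2 = 1 by rewrite -rmorphM -(rmorph1 emb); congr (emb _); lra.
have ball2 (z : X) : nr z <= 1 / 2 -> nr (emb 2 *: z) <= 1.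
  by move=> z2; rewrite nrZemb ger0_norm//; move: z2; lra.
have E (z : X) : z = emb (1 / 2) *: (emb 2 *: z) by rewrite scalerA h2 scale1r.
have := rd (ball2 _ x2) (ball2 _ y2) (t := 1 / 2).
have -> : 1 - 1 / 2 = 1 / 2 :> R by lra.
rewrite -!E => /(_ _)H; have {H} := H half01.
have := r_scale (ball2 _ x2) half01; have := r_scale (ball2 _ y2) half01.
by rewrite -!E !ler_norml; lra.
Qed.

(* If [r] were the real part of a linear function, that function would be [g]. *)
Let g x : K := emb (r x) - imu * emb (r (imu *: x)).

Let re_g x : re (g x) = r x.
Proof. by rewrite /g reB re_imu_emb re_emb subr0. Qed.

Let g0 : g 0 = 0.
Proof. by rewrite /g scaler0 r0 rmorph0 mulr0 subrr. Qed.

Let nr_emb2 (a b c : R) : `|a| <= c -> `|b| <= c ->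
  nr (emb a - imu * emb b) <= c + c.
Proof.
move=> ac bc; rewrite (le_trans (nrB _ _ _))// lerD ?nr_emb//.
by rewrite (le_trans (nr_imuM _ _))// nr_emb.
Qed.

Let g_add x y : nr x <= 1 / 2 -> nr y <= 1 / 2 ->
  nr (g (x + y) - g x - g y) <= 6 * d.
Proof.
move=> x2 y2; rewrite /g scalerDr.
have -> : forall a b c a' b' c', emb a - imu * emb a' - (emb b - imu * emb b') -
    (emb c - imu * emb c') =
    emb (a - b - c) - imu * emb (a' - b' - c').
  by move=> *; rewrite !rmorphB /=; ring.
have -> : 6 * d = 3 * d + 3 * d by ring.
by apply: nr_emb2; apply: r_add => //; exact: nrZi.
Qed.

Let g_real (t : R) (x : X) : nr x <= 1 -> `|t| <= 1 ->
  nr (g (emb t *: x) - emb t * g x) <= 6 * d.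
Proof.
move=> x1 t1; rewrite /g scalerA [imu * emb t]mulrC -scalerA.
have -> : forall a b a' b', emb a - imu * emb a' - emb t * (emb b - imu * emb b') =
    emb (a - t * b) - imu * emb (a' - t * b').
  by move=> *; rewrite !rmorphB !rmorphM /=; ring.
have -> : 6 * d = 3 * d + 3 * d by ring.
by apply: nr_emb2; apply: r_real => //; exact: nrZi.
Qed.

Let g_imu (x : X) : nr x <= 1 -> nr (g (imu *: x) - imu * g x) <= 2 * d.
Proof.
move=> x1; rewrite /g scalerA; case: (imu_cases S) => [->|ii].
  by rewrite !mul0r scale0r r0 rmorph0 !subrr nr0 mulr_ge0.
rewrite mulrBr mulrA ii mulN1r scaleN1r.
have -> : emb (r (imu *: x)) - imu * emb (r (- x)) - (imu * emb (r x) - - emb (r (imu *: x)))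
  = - (imu * emb (r (- x) + r x)) by rewrite rmorphD /=; ring.
by rewrite nrN (le_trans (nr_imuM _ _))// nr_emb r_opp.
Qed.

Let g_hom (z : K) (x : X) : nr z <= 1 -> nr x <= 1 / 2 -> nr (g (z *: x) - z * g x) <= 20 * d.
Proof.
move=> z1 x2; have x1 : nr x <= 1 by move: x2; lra.
pose a := re z; pose b := - re (imu * z).
have a1 : `|a| <= 1 by exact: le_trans (norm_re_le _ _) z1.
have b1 : `|b| <= 1.
  by rewrite normrN (le_trans (norm_re_le _ _))// (le_trans (nr_imuM _ _)).
have zE : z = emb a + emb b * imu.
  by rewrite {1}(re_decomp S z) /b rmorphN /= mulNr [imu * _]mulrC.
have ix := nrZi x2; have ix1 := nrZi x1.
have halfZ t (y : X) : `|t| <= 1 -> nr y <= 1 / 2 -> nr (emb t *: y) <= 1 / 2.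
  by move=> t1; rewrite nrZemb; apply: le_trans; rewrite ler_piMl ?nr_ge0.
have -> : g (z *: x) - z * g x =
  (g (emb a *: x + emb b *: (imu *: x)) - g (emb a *: x) - g (emb b *: (imu *: x)))
  + (g (emb a *: x) - emb a * g x)
  + ((g (emb b *: (imu *: x)) - emb b * g (imu *: x))
  + emb b * (g (imu *: x) - imu * g x)).
  have -> : emb a *: x + emb b *: (imu *: x) = z *: x.
    by rewrite scalerA -scalerDl -zE.
  have -> : z * g x = emb a * g x + emb b * (imu * g x).
    by rewrite {1}zE mulrDl mulrA.
  by ring.
have h1 := g_add (halfZ _ _ a1 x2) (halfZ _ _ b1 ix).
have h2 := g_real x1 a1; have h3 := g_real ix1 b1; have h4 := g_imu x1.
have -> : 20 * d = (6 * d + 6 * d) + (6 * d + 2 * d) by ring.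
rewrite (le_trans (nrD _ _ _))// lerD//.
  by rewrite (le_trans (nrD _ _ _))// lerD.
rewrite (le_trans (nrD _ _ _))// lerD// nrM nr_emb (le_trans _ h4)//.
by rewrite ler_piMl ?nr_ge0.
Qed.

(* A representative of norm [1 / 2] of each line, and the coordinate along it. *)
Let e x : X := xget 0 [set y | nr y = 1 / 2 /\ exists2 c, c != 0 & y = c *: x].
Let lam x : K := xget 0 [set c | x = c *: e x].

Let e_spec (x : X) : x != 0 -> nr (e x) = 1 / 2 /\ exists2 c, c != 0 & e x = c *: x.
Proof.
move=> x0; apply: (@xgetPex _ 0 [set y | nr y = 1 / 2 /\ _]).
have nx : 0 < nr x by rewrite nr_gt0.
have c0 : 0 < (2 * nr x)^-1 by rewrite invr_gt0 mulr_gt0.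
exists (emb (2 * nr x)^-1 *: x); split.
  by rewrite nrZemb ger0_norm ?ltW// invfM -mulrA mulVf ?gt_eqF// mulr1 mul1r.
by exists (emb (2 * nr x)^-1) => //; rewrite gt_eqF// emb_gt0.
Qed.

Let e_neq0 (x : X) : x != 0 -> e x != 0.
Proof. by move=> /e_spec[ex _]; rewrite -(nr_eq0 S) ex; apply/eqP; lra. Qed.

Let lam_spec (x : X) : x != 0 -> x = lam x *: e x.
Proof.
move=> x0; apply: (@xgetPex _ 0 [set c | x = c *: e x]).
have [_ [c c0 ec]] := e_spec x0.
by exists c^-1; rewrite /= ec scalerA mulVf// scale1r.
Qed.

Let eZ (c : K) (x : X) : c != 0 -> e (c *: x) = e x.
Proof.
move=> c0; rewrite /e; congr (xget _ _); apply/funext => y /=.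
apply/propext; split=> -[y2 [b b0 yE]]; split => //.
  by exists (b * c); rewrite ?mulf_neq0// -scalerA.
by exists (b * c^-1); rewrite ?mulf_neq0 ?invr_eq0// scalerA divfK.
Qed.

Let F x : K := lam x * g (e x).

Let F0 : F 0 = 0.
Proof.
rewrite /F; suff -> : e 0 = 0 by rewrite g0 mulr0.
apply: xgetPN => y [+ [c _ yE]]; rewrite yE scaler0 nr0.
by lra.
Qed.

Let FZ (c : K) (x : X) : F (c *: x) = c * F x.
Proof.
have [->|c0] := eqVneq c 0; first by rewrite scale0r F0 mul0r.
have [->|x0] := eqVneq x 0; first by rewrite scaler0 F0 mulr0.
rewrite /F eZ// mulrA; congr (_ * _).
have cx0 : c *: x != 0 by rewrite scaler_eq0 negb_or c0.
have := lam_spec cx0; rewrite eZ// {1}(lam_spec x0) scalerA => /eqP.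
rewrite -subr_eq0 -scalerBl scaler_eq0 (negbTE (e_neq0 x0)) orbF subr_eq0.
by move=> /eqP.
Qed.

Let F_g (x : X) : nr x <= 1 / 2 -> nr (F x - g x) <= 20 * d.
Proof.
move=> x2; have [->|x0] := eqVneq x 0.
  by rewrite F0 g0 subrr nr0 mulr_ge0.
have [e2 _] := e_spec x0.
rewrite {2}(lam_spec x0) /F nrC g_hom ?e2//.
by move: x2; rewrite {1}(lam_spec x0) nrZ e2; lra.
Qed.

Let F_quasi (x y : X) : nr (F (x + y) - F x - F y) <= 132 * d * (nr x + nr y).
Proof.
have nx := nr_ge0 S x; have ny := nr_ge0 S y.
have [s0|s0] := eqVneq (nr x + nr y) 0.
  have -> : x = 0 by apply/eqP; rewrite -(nr_eq0 S); apply/eqP; lra.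
  have -> : y = 0 by apply/eqP; rewrite -(nr_eq0 S); apply/eqP; lra.
  by rewrite addr0 F0 !subr0 !nr0 addr0 mulr0.
set s := nr x + nr y in s0 *.
have {}s0 : 0 < s by rewrite lt_neqAle eq_sym s0 addr_ge0.
pose c := (2 * s)^-1; have c0 : 0 < c by rewrite invr_gt0 mulr_gt0.
have cs : c * s = 1 / 2 by rewrite /c invfM -mulrA mulVf ?gt_eqF// mul1r mulr1.
have small (z : X) : nr z <= s -> nr (emb c *: z) <= 1 / 2.
  by move=> zs; rewrite nrZemb gtr0_norm// -cs ler_pM2l.
have x2 := small x ltac:(by rewrite /s; lra).
have y2 := small y ltac:(by rewrite /s; lra).
have xy2 := small (x + y) (nrD S x y).
suff H : c * nr (F (x + y) - F x - F y) <= 66 * d.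
  rewrite -(ler_pM2l c0) (le_trans H)//.
  by rewrite mulrCA -mulrA cs; have := d0; lra.
rewrite -[c]gtr0_norm// -(nr_emb S) -nrM !mulrBr -!FZ scalerDr.
rewrite scalerDr in xy2.
set x' := emb c *: x in x2 xy2 *; set y' := emb c *: y in y2 xy2 *.
have -> : F (x' + y') - F x' - F y' =
  (F (x' + y') - g (x' + y')) - (F x' - g x') - (F y' - g y') +
  (g (x' + y') - g x' - g y') by ring.
have -> : 66 * d = 20 * d + 20 * d + 20 * d + 6 * d by ring.
rewrite (le_trans (nrD _ _ _))// lerD//; last exact: (g_add x2 y2).
rewrite (le_trans (nrB _ _ _))// lerD ?F_g//.
by rewrite (le_trans (nrB _ _ _))// lerD ?F_g//.
Qed.

Let F_r (x : X) : nr x <= 1 -> `|r x - re (F x)| <= 42 * d.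
Proof.
move=> x1; pose h := emb (1 / 2) *: x.
have h2 : nr h <= 1 / 2 by rewrite nrZemb ger0_norm; lra.
have : `|re (g h - F h)| <= 20 * d.
  by rewrite (le_trans (norm_re_le _ _))// nrC F_g.
rewrite reB re_g /h FZ re_embM.
have := r_scale x1 (t := 1 / 2) half01.
by rewrite !ler_norml; lra.
Qed.

(** Complexifying [r] gives a function [g] on the ball which is nearly additive
  and nearly compatible with scalars. Keeping the values of [g] only at one
  representative of each line, and extending them homogeneously, changes [g]
  little, so that the result is quasilinear. *)
Lemma homogenize : exists F : X -> K,
  [/\ homogeneous F,
      forall x y, nr (F (x + y) - F x - F y) <= 132 * d * (nr x + nr y) &
      forall x, nr x <= 1 -> `|r x - re (F x)| <= 42 * d].
Proof. by exists F; split; [exact: FZ|exact: F_quasi|exact: F_r]. Qed.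

End Homogenization.

(** * A uniform constant for quasilinear functions *)

Section UniformApproximation.
Variables (R : realType) (K : numFieldType) (S : real_form R K).
Variable (X : normedModType K).
Local Notation nr := (nr S).
Local Notation emb := (emb S).
Implicit Types (F G : X -> K) (x y : X).

Definition quasi (q : R) F :=
  homogeneous F /\ forall x y, nr (F (x + y) - F x - F y) <= q * (nr x + nr y).

Definition near_linear (C : R) F :=
  exists2 l : X -> K, klin l & forall x, nr (F x - l x) <= C * nr x.

Lemma homogeneous0 F : homogeneous F -> F 0 = 0.
Proof. by move=> /(_ 0 0); rewrite scale0r mul0r. Qed.

Lemma homogeneous_bound F (m : R) : homogeneous F ->
  (forall x, nr x <= 1 -> nr (F x) <= m) -> forall x, nr (F x) <= m * nr x.
Proof.
move=> hF Fm x; have [->|x0] := eqVneq x 0.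
  by rewrite homogeneous0// !nr0 mulr0.
have nx : 0 < nr x by rewrite nr_gt0.
have c0 : 0 < (nr x)^-1 by rewrite invr_gt0.
rewrite -ler_pdivrMr// mulrC -[(nr x)^-1]gtr0_norm// -(nr_emb S) -nrM -hF.
by apply: Fm; rewrite nrZ nr_emb gtr0_norm// mulVf// gt_eqF.
Qed.

Lemma K_space_near_linear : K_space X ->
  forall q F, quasi q F -> exists C, near_linear C F.
Proof.
move=> hX q F [hF qF]; have [|l [b [[hb [M bM]] FE]]] := hX F.
  split => //; exists (emb q) => x y.
  by rewrite -!(emb_nr S) -rmorphD -rmorphM ler_emb.
exists (re S M), (l : X -> K); first by move=> a x y; rewrite linearP.
move=> x; have -> : F x - l x = b x by rewrite FE addrC addrA addNr add0r.
apply: homogeneous_bound => // y y1.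
rewrite -(ler_emb S) emb_nr emb_re_ge0; last first.
  by rewrite (le_trans _ (bM 0 _))// /unit_ball /= normr0.
by apply: bM; rewrite /unit_ball /= -(rmorph1 emb) nr_le.
Qed.

(** Linear maps that are good on larger and larger finite sets are bounded at
  each point, so they have a limit along an ultrafilter. *)
Lemma near_linear_finite (C : R) F :
  (forall T : seq X, exists2 l : X -> K, klin l &
     forall x, x \in T -> nr (F x - l x) <= C * nr x) -> near_linear C F.
Proof.
move=> FT; have /choice[l lT] : forall T : seq X, exists l : X -> K, klin l /\
    forall x, x \in T -> nr (F x - l x) <= C * nr x.
  by move=> T; have [l ll lT] := FT T; exists l.
pose E : set_system (seq X) := [set A | exists T0 : seq X,
  forall T : seq X, {subset T0 <= T} -> A T].
have FE : ProperFilter E.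
  apply: Build_ProperFilter_ex => [A [T AT]|]; first by exists T; exact: AT.
  split=> [|A B [T AT] [T' BT]|A B AB [T AT]].
  - by exists [::].
  - exists (T ++ T') => V TV; split; [apply: AT|apply: BT] => x xT;
      by apply: TV; rewrite mem_cat xT ?orbT.
  - by exists T => V /AT/AB.
have [U [UU EU]] := ultraFilterLemma FE.
have PU : ProperFilter U by case: UU.
have Ux x : U [set T | nr (l T x - F x) <= C * nr x].
  apply: EU; exists [:: x] => T xT; rewrite /= nrC; apply: (lT T).2.
  by apply: xT; rewrite mem_head.
have lim x : ulim_to S U (l ^~ x) (ulim S U (l ^~ x)).
  apply: (@ulimP _ _ _ _ _ _ _ (C * nr x + nr (F x))).
  apply: filterS (Ux x) => T /= Tx.
  have -> : l T x = l T x - F x + F x by rewrite subrK.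
  by rewrite (le_trans (nrD _ _ _))// lerD.
exists (fun x => ulim S U (l ^~ x)).
  by apply: (ulim_klin UU _ lim) => T; have [] := lT T.
move=> x; have lx := ulim_lin UU (-1) (lim x) (ulim_cst S UU (F x)).
rewrite addrC -mulN1r; apply: (ulim_le UU lx).
by apply: filterS (Ux x) => T /= Tx; rewrite mulN1r addrC nrC.
Qed.

Let Q1 := {F : X -> K | quasi 1 F}.

(** The family of all quasilinear functions with constant 1 is linear modulo
  bounded families, so [linear_lift] subtracts a linear map from each of them in
  such a way that the results are bounded at each point. This makes infinite
  combinations of quasilinear functions converge. *)
Lemma quasi_pointwise_bound : exists M : X -> R, forall F, quasi 1 F ->
  exists2 l : X -> K, klin l & forall x, nr (F x - l x) <= M x.
Proof.
pose Z : set (Q1 -> K^o) := [set u | exists m : R, forall F : Q1, nr (u F : K) <= m].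
pose G (x : X) (F : Q1) : K^o := sval F x.
have [a u v [m um] [n vn]|a x y|L [Llin LZ]] := @linear_lift K X (Q1 -> K^o) Z G.
- exists (nr a * m + n) => F; rewrite (le_trans (nrD _ _ _))// lerD//.
  by rewrite nrM ler_wpM2l ?nr_ge0.
- exists (nr (a *: x) + nr y) => -[F [hF qF]].
  have := qF (a *: x) y; rewrite mul1r hF; congr (_ <= _).
  by congr (nr _); rewrite /G /= -!/(GRing.add _ _); rewrite opprD addrA.
have /choice[M LM] := LZ.
exists M => F qF; pose F1 : Q1 := exist _ F qF.
exists (fun x => L x F1) => [a x y|x]; first by rewrite Llin.
exact: LM x F1.
Qed.

Hypothesis hX : K_space X.

Section Hump.
Variable M : X -> R.
Hypothesis MP : forall F, quasi 1 F ->
  exists2 l : X -> K, klin l & forall x, nr (F x - l x) <= M x.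
Hypothesis nounif : forall C, exists2 F, quasi 1 F & ~ near_linear C F.

Lemma quasi_sub_klin q F l : quasi q F -> klin l -> quasi q (fun x => F x - l x).
Proof.
move=> [hF qF] ll; split=> [c x|x y]; first by rewrite hF (klinZ ll) mulrBr.
have -> : F (x + y) - l (x + y) - (F x - l x) - (F y - l y) = F (x + y) - F x - F y.
  by rewrite (klinD ll); ring.
exact: qF.
Qed.

Lemma quasi_comb q p (a : K) F G : quasi q F -> quasi p G ->
  quasi (q + nr a * p) (fun x => F x + a * G x).
Proof.
move=> [hF qF] [hG qG]; split=> [c x|x y]; first by rewrite hF hG; ring.
have -> : F (x + y) + a * G (x + y) - (F x + a * G x) - (F y + a * G y) =
  (F (x + y) - F x - F y) + a * (G (x + y) - G x - G y) by ring.
rewrite (le_trans (nrD _ _ _))// mulrDl lerD// nrM -mulrA.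
by rewrite ler_wpM2l ?nr_ge0.
Qed.

Lemma near_linear_le C D F : C <= D -> near_linear C F -> near_linear D F.
Proof.
move=> CD [l ll Fl]; exists l => // x; rewrite (le_trans (Fl x))//.
by rewrite ler_wpM2r ?nr_ge0.
Qed.

(* One step of the gliding hump: the next partial sum [G'] and all its
   perturbations of the size allowed by [e'] are far from linear. *)
Let step (n : nat) (s s' : (X -> K) * R) :=
  [/\ 0 < s'.2 <= s.2 / 2, exists q, quasi q s'.1,
      (forall x, nr (s'.1 x - s.1 x) <= s.2 * M x),
      (forall x y, nr (s'.1 (x + y) - s'.1 x - s'.1 y -
           (s.1 (x + y) - s.1 x - s.1 y)) <= s.2 * (nr x + nr y)) &
      forall T : X -> K, (forall x, nr (T x - s'.1 x) <= 2 * s'.2 * M x) ->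
        ~ near_linear n%:R T].

(** Adding a small multiple of a function that is very far from linear, as
  witnessed on a finite set [T], dominates the distance of the previous partial
  sum to linear maps. Later perturbations are harmless once they are bounded on
  [T] by the norm. *)
Lemma hump_step n s : 0 < s.2 -> (exists q, quasi q s.1) -> exists s', step n s s'.
Proof.
case: s => G e /= e0 [q qG].
have [A GA] := K_space_near_linear hX qG.
pose C := (n%:R + A + 1) / e.
have [F0 qF0 F0C] := nounif C.
have [l0 ll0 F0M] := MP qF0.
pose F x := F0 x - l0 x.
have qF : quasi 1 F by exact: quasi_sub_klin.
have FC : ~ near_linear C F.
  move=> [l ll Fl]; apply: F0C; exists (fun x => 1 * l0 x + l x).
    exact: klin_comb.
  move=> x; have -> : F0 x - (1 * l0 x + l x) = F x - l x by rewrite /F; ring.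
  exact: Fl.
have [T FT] : exists T : seq X, ~ exists2 l : X -> K, klin l &
    forall x, x \in T -> nr (F x - l x) <= C * nr x.
  apply: contrapT => nT; apply: FC; apply: near_linear_finite => T.
  by apply: contrapT => nl; apply: nT; exists T.
have [c c0 cT] : exists2 c : R, 0 < c & forall x, x \in T -> x != 0 -> M x <= c * nr x.
  elim: (T) => [|y s [c c0 cs]]; first by exists 1.
  exists (c + `|M y| / nr y).
    by rewrite ltr_wpDr// divr_ge0 ?nr_ge0.
  move=> x; rewrite inE => /predU1P[->|xs] x0.
    rewrite mulrDl divfK ?nr_eq0//.
    by rewrite (le_trans (ler_norm _))// lerDr mulr_ge0 ?nr_ge0 ?ltW.
  rewrite (le_trans (cs x xs x0))// ler_wpM2r ?nr_ge0// lerDl.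
  by rewrite divr_ge0 ?nr_ge0.
pose e' := Num.min (e / 2) (2 * c)^-1.
have e'0 : 0 < e' by rewrite lt_min divr_gt0//= invr_gt0 mulr_gt0.
have e'c : 2 * e' * c <= 1.
  have : e' <= (2 * c)^-1 by rewrite ge_min lexx orbT.
  rewrite -(ler_pM2r (x := 2 * c)) ?mulr_gt0// mulVf ?gt_eqF ?mulr_gt0//.
  by lra.
exists (fun x => G x + emb e * F x, e'); split => /=.
- by rewrite e'0 ge_min lexx.
- by exists (q + nr (emb e) * 1); exact: quasi_comb.
- move=> x; have -> : G x + emb e * F x - G x = emb e * F x by ring.
  by rewrite nrM nr_emb gtr0_norm// ler_pM2l//; exact: F0M.
- move=> x y; set B := (X in nr X <= _).
  have -> : B = emb e * (F (x + y) - F x - F y) by rewrite /B; ring.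
  rewrite nrM nr_emb gtr0_norm// ler_pM2l//.
  by have [_ /(_ x y)] := qF; rewrite mul1r.
move=> T1 T1M [l ll T1l]; have [lG llG GlG] := GA.
apply: FT; exists (fun x => emb e^-1 * (-1 * lG x + l x)).
  move=> a x y; rewrite ll llG; ring.
move=> x xT; have [->|x0] := eqVneq x 0.
  have /homogeneous0-> : homogeneous F by case: qF.
  by rewrite (klin0 llG) (klin0 ll) mulr0 addr0 mulr0 subr0 !nr0 mulr0.
have ee : emb e^-1 * emb e = 1 by rewrite -rmorphM mulVf ?rmorph1 ?gt_eqF.
have -> : F x - emb e^-1 * (-1 * lG x + l x) =
   emb e^-1 * ((T1 x - l x) - (G x - lG x) - (T1 x - (G x + emb e * F x))).
  have -> : emb e^-1 * (T1 x - l x - (G x - lG x) - (T1 x - (G x + emb e * F x)))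
    = emb e^-1 * emb e * F x - emb e^-1 * (-1 * lG x + l x) by ring.
  by rewrite ee mul1r.
rewrite nrM nr_emb gtr0_norm ?invr_gt0// /C mulrAC [X in _ <= X]mulrC.
rewrite ler_pM2l ?invr_gt0// !mulrDl mul1r.
rewrite (le_trans (nrB _ _ _))// lerD//.
  by rewrite (le_trans (nrB _ _ _))// lerD.
rewrite (le_trans (T1M x))// (le_trans (ler_wpM2l _ (cT x xT x0)))//.
  by rewrite mulr_ge0 ?ltW.
by rewrite mulrA ler_piMl ?nr_ge0.
Qed.

(** The limit of the partial sums is quasilinear, but for every [n] it is a small
  perturbation of the partial sum of index [n.+1], hence not within [n] of a
  linear map. *)
Lemma hump_contradiction : False.
Proof.
pose st := {s : (X -> K) * R * nat | 0 < s.1.2 /\ exists q, quasi q s.1.1}.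
pose Rst (s t : st) := step (sval s).2 (sval s).1 (sval t).1 /\ (sval t).2 = (sval s).2.+1.
have Rex s : {t | Rst s t}.
  apply: cid; case: s => [[s n] [s0 sq]] /=.
  have [s' H] := hump_step n s0 sq.
  have s'0 : 0 < s'.2 by case: H => /andP[].
  have s'q : exists q, quasi q s'.1 by case: H.
  by exists (exist _ (s', n.+1) (conj s'0 s'q)).
have q0 : quasi 0 (fun=> 0 : K).
  by split=> [c x|x y]; rewrite ?mulr0// !subr0 nr0 mul0r.
have s00 : 0 < (1 : R) /\ exists q, quasi q (fun=> 0 : K).
  by split; [exact: ltr01|exists 0].
pose s0 : st := exist _ ((fun=> 0 : K, 1), 0%N) s00.
have [f [f0 fS]] := dependent_choice Rex s0.
pose G n := (sval (f n)).1.1; pose e n := (sval (f n)).1.2.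
have fn n : (sval (f n)).2 = n.
  by elim: n => [|n IH]; rewrite ?f0//; have [_ ->] := fS n; rewrite IH.
have e_gt0 n : 0 < e n by have [] := svalP (f n).
have stepn n : step n (G n, e n) (G n.+1, e n.+1).
  have [+ _] := fS n; rewrite fn /G /e.
  by case: (sval (f n)) => [[? ?] ?]; case: (sval (f n.+1)) => [[? ?] ?].
have eS n : 2 * (e n - e n.+1) >= e n.
  by have [/= /andP[_ +] _ _ _ _] := stepn n; lra.
have e_anti n k : e (n + k)%N <= e n.
  elim: k => [|k]; rewrite ?addn0// addnS => /(le_trans _); apply.
  by have := eS (n + k)%N; have := e_gt0 (n + k)%N; lra.
have M0 x : 0 <= M x.
  have [F qF _] := nounif 0; have [l _ Fl] := MP qF.
  exact: le_trans (nr_ge0 _ _) (Fl x).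
have GM n k x : nr (G (n + k)%N x - G n x) <= 2 * (e n - e (n + k)%N) * M x.
  elim: k => [|k IH]; first by rewrite addn0 !subrr nr0 mulr0 mul0r.
  rewrite addnS; have [_ _ /(_ x) /= H _ _] := stepn (n + k)%N.
  have -> : G (n + k).+1 x - G n x = (G (n + k).+1 x - G (n + k)%N x) +
    (G (n + k)%N x - G n x) by ring.
  rewrite (le_trans (nrD _ _ _))// (le_trans (lerD H IH))// -mulrDl.
  by rewrite ler_wpM2r//; have := eS (n + k)%N; lra.
pose D n x y := G n (x + y) - G n x - G n y.
have GD k x y : nr (D k x y) <= 2 * (e 0%N - e k) * (nr x + nr y).
  elim: k => [|k IH].
    by rewrite /D /G f0 /= !subr0 nr0 subrr mulr0 mul0r.
  have [_ _ _ /(_ x y) /= H _] := stepn k.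
  have -> : D k.+1 x y = (D k.+1 x y - D k x y) + D k x y by ring.
  rewrite (le_trans (nrD _ _ _))// (le_trans (lerD H IH))// -mulrDl.
  by rewrite ler_wpM2r ?addr_ge0 ?nr_ge0//; have := eS k; lra.
have [U [UU _ Uf]] := free_ultrafilter infinite_nat.
have PU : ProperFilter U by case: UU.
have Uge n : U [set k | (n <= k)%N].
  by apply: filterS (Uf _ (finite_II n)) => k /= kn; rewrite leqNgt; exact/negP.
have G2 n x : U [set k | nr (G k x - G n x) <= 2 * e n * M x].
  apply: filterS (Uge n) => k /= nk; rewrite -(subnKC nk).
  rewrite (le_trans (GM _ _ _))// ler_wpM2r//.
  by have := e_gt0 (n + (k - n))%N; lra.
pose T x := ulim S U (G ^~ x).
have lim x : ulim_to S U (G ^~ x) (T x).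
  apply: (@ulimP _ _ _ _ _ _ _ (2 * e 0%N * M x)).
  have G0 : G 0%N x = 0 by rewrite /G f0.
  by apply: filterS (G2 0%N x) => k /=; rewrite G0 subr0.
have qT : quasi (2 * e 0%N) T.
  split=> [c x|x y].
    apply: (ulim_unique UU (lim _)).
    have := ulim_lin UU c (lim x) (ulim_cst S UU 0); rewrite addr0.
    congr (ulim_to _ _ _ _); apply/funext => n; rewrite addr0.
    by have [_ [p [hG _]]] := svalP (f n); rewrite /G hG.
  have := ulim_lin UU (-1) (lim x) (lim (x + y)).
  move=> /(ulim_lin UU (-1) (lim y))/(ulim_le UU).
  have -> : -1 * T y + (-1 * T x + T (x + y)) = T (x + y) - T x - T y by ring.
  apply; apply: filterS filterT => k _ /=.
  have -> : -1 * G k y + (-1 * G k x + G k (x + y)) = D k x y by rewrite /D; ring.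
  rewrite (le_trans (GD _ _ _))// ler_wpM2r ?addr_ge0 ?nr_ge0//.
  by have := e_gt0 k; lra.
have [C TC] := K_space_near_linear hX qT.
pose n := Num.truncn `|C|.
have [_ _ _ _ /(_ T)] := stepn n.+1; apply.
  move=> x; apply: (ulim_le UU (u := fun k => -1 * G n.+2 x + G k x)).
    have := ulim_lin UU (-1) (ulim_cst S UU (G n.+2 x)) (lim x).
    by rewrite mulN1r addrC.
  apply: filterS (G2 n.+2 x) => k /= kx.
  by rewrite mulN1r addrC.
apply: near_linear_le TC; rewrite (le_trans (ler_norm C))// ltW//.
exact: truncnS_gt.
Qed.

End Hump.

(** The definition of a K-space gives for each quasilinear function some distance
  to linear maps; a gliding hump argument bounds it by a multiple of the constant
  of quasilinearity. *)
Lemma K_space_uniform : exists2 C : R, 0 <= C &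
  forall q F, quasi q F -> near_linear (C * q) F.
Proof.
have [M MP] := quasi_pointwise_bound.
have [C CP] : exists C, forall F, quasi 1 F -> near_linear C F.
  apply: contrapT => nC; apply: (hump_contradiction MP) => C.
  apply: contrapT => nF; apply: nC; exists C => F qF.
  by apply: contrapT => nl; apply: nF; exists F.
exists `|C| => // q F qF; have [q0|q0] := leP q 0.
  have lF : klin F.
    move=> a x y; have [hF /(_ (a *: x) y)] := qF; rewrite hF => H.
    apply/eqP; rewrite -subr_eq0 -(nr_eq0 S) eq_le nr_ge0 andbT opprD addrA.
    by rewrite (le_trans H)// mulr_le0_ge0// addr_ge0 ?nr_ge0.
  exists F => // x; rewrite subrr nr0.
  have [x0|x0] := eqVneq x 0; first by rewrite x0 nr0 mulr0.
  have [_ /(_ x x)] := qF; rewrite (klinD lF) addrK subrr nr0 -mulr2n mulrnAr pmulrn_lge0// => qx.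
  by rewrite -mulrA mulr_ge0.
have q1 : quasi 1 (fun x => emb q^-1 * F x).
  have [hF qF'] := qF; split=> [c x|x y]; first by rewrite hF; ring.
  have -> : emb q^-1 * F (x + y) - emb q^-1 * F x - emb q^-1 * F y =
     emb q^-1 * (F (x + y) - F x - F y) by ring.
  by rewrite nrM nr_emb gtr0_norm ?invr_gt0// mul1r mulrC ler_pdivrMr// mulrC.
have [l ll lF] := near_linear_le (ler_norm C) (CP _ q1).
exists (fun x => emb q * l x); first by move=> a x y; rewrite ll; ring.
move=> x; have qq : emb q * emb q^-1 = 1 by rewrite -rmorphM divff ?rmorph1 ?gt_eqF.
have -> : F x - emb q * l x = emb q * (emb q^-1 * F x - l x).
  by rewrite mulrBr mulrA qq mul1r.
by rewrite nrM nr_emb gtr0_norm// mulrAC mulrC ler_pM2r.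
Qed.

End UniformApproximation.

(** * Null sequences *)

Section NullSequenceSpace.
Variables (R : realType) (K : numFieldType) (S : real_form R K).
Local Notation nr := (nr S).

Definition vanishing (v : nat -> K) :=
  forall e : R, 0 < e -> finite_set [set n | e <= nr (v n)].

Lemma c0_coord (u : c0 K) n : nr (u n) <= nr u.
Proof.
rewrite -(ler_emb S) !emb_nr; have [m um le_m] := c0_norm_max u.
by have -> : `|u| = `|u m| by exact: um.
Qed.

Lemma c0_le (u : c0 K) c : (forall n, nr (u n) <= c) -> nr u <= c.
Proof.
move=> uc; rewrite -nr_le; have [m um _] := c0_norm_max u.
by have -> : `|u| = `|u m|; [exact: um|rewrite nr_le].
Qed.

Lemma finite_nat_bound (A : set nat) :
  finite_set A <-> exists N, forall n, (N <= n)%N -> ~ A n.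
Proof.
split=> [/finite_fsetP[F ->]|[N NA]].
  have [N FN] := ltn_seq_bound (finmap.enum_fset F).
  by exists N => n Nn nF; have := FN n nF; rewrite ltnNge Nn.
apply: sub_finite_set (finite_II N) => n An /=.
by rewrite ltnNge; apply/negP => /NA.
Qed.

Lemma c0_vanishing (u : c0 K) : vanishing u.
Proof.
move=> e e0; apply/finite_nat_bound.
have /null_seqP/cvgr0Pnorm_lt/(_ (emb S e)) := valP u.
rewrite emb_gt0 => /(_ e0)[N _ Nu]; exists N => n Nn /=.
by apply/negP; rewrite -ltNge -nr_lt; exact: Nu.
Qed.

Lemma vanishing_c0 (v : nat -> K) : vanishing v -> exists u : c0 K, forall n, u n = v n.
Proof.
move=> v0; suff vP : v \in @null_seq K by exists (C0 vP).
apply/null_seqP/cvgr0Pnorm_lt => e e0.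
have eE : emb S (re S e) = e by rewrite emb_re_ge0// ltW.
have re0 : 0 < re S e by rewrite -(emb_gt0 S) eE.
have /finite_nat_bound[N Nv] := v0 _ re0.
exists N => // n Nn /=; rewrite -eE nr_lt ltNge.
by apply/negP; exact: Nv.
Qed.

Lemma vanishingD (a : K) (u v : nat -> K) : vanishing u -> vanishing v ->
  vanishing (fun n => a * u n + v n).
Proof.
move=> u0 v0 e e0.
have a1 : 0 < nr a + 1 by rewrite ltr_wpDl ?nr_ge0.
have d0 : 0 < e / 2 / (nr a + 1) by rewrite !divr_gt0.
have e20 : 0 < e / 2 by rewrite divr_gt0.
have := conj (u0 _ d0) (v0 _ e20); rewrite -finite_setU.
apply: sub_finite_set => n /=; apply: contraPP => /not_orP[/negP + /negP].
rewrite -!ltNge => un vn; apply/negP; rewrite -ltNge.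
rewrite (le_lt_trans (nrD _ _ _))// [ltRHS]splitr ler_ltD// nrM.
have : nr a * nr (u n) <= (nr a + 1) * nr (u n).
  by rewrite ler_wpM2r ?nr_ge0// lerDl.
move=> /le_trans; apply; rewrite mulrC -ler_pdivlMr//; exact: ltW.
Qed.

Lemma vanishing_le (c : R) (u v : nat -> K) : 0 < c ->
  (forall n, nr (v n) <= c * nr (u n)) -> vanishing u -> vanishing v.
Proof.
move=> c0 vu u0 e e0; apply: sub_finite_set (u0 _ (divr_gt0 e0 c0)) => n /= en.
by rewrite ler_pdivrMr// mulrC (le_trans en).
Qed.

End NullSequenceSpace.

(** * Bounded functions: the first constant is finite *)

Section Infimum.
Variables (R : realType) (K : numFieldType) (S : real_form R K).

(** In the complex case the order is only partial, but a lower bound of a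
  nonempty set of nonnegative reals is itself real, so that the infimum is the
  embedded real infimum. *)
Lemma infimum_fin_num (A : set K) : A !=set0 -> (forall c, A c -> 0 <= c) ->
  infimum +oo%E [set c%:E | c in A] \is a fin_num.
Proof.
move=> [c0 Ac0] A0; pose B := re S @` A; pose m := inf B.
have BE c : A c -> emb S (re S c) = c by move=> /A0; exact: emb_re_ge0.
have Blb : lbound B 0.
  by move=> _ [c Ac <-]; rewrite -(emb_ge0 S) BE// A0.
have Binf : has_inf B by split; [exists (re S c0), c0|exists 0].
have mreal (x : R) : emb S x \is Num.real.
  by have := num_real x; rewrite !realE -!(rmorph0 (emb S)) !ler_emb.
have infm : infimums [set c%:E | c in A] (emb S m)%:E.
  split=> [_ [c Ac <-]|y ylb].
    rewrite lee_fin -(BE c Ac) ler_emb; apply: ge_inf; first by exists 0.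
    by exists c.
  have {}ylb c : A c -> (y <= c%:E)%E by move=> Ac; apply: ylb; exists c.
  case: y ylb => [z| |] ylb.
  - have zc c : A c -> emb S (re S z) = z /\ re S z <= re S c.
      move=> Ac; have := ylb c Ac; rewrite lee_fin => zc.
      have cz : 0 <= c - z by rewrite subr_ge0.
      have zE : z = emb S (re S z).
        have := emb_re_ge0 S cz; rewrite reB rmorphB /= (BE c Ac) => /addrI/oppr_inj.
        by [].
      by split; [exact: esym|rewrite -(ler_emb S) -zE BE].
    rewrite lee_fin -(zc c0 Ac0).1 ler_emb; apply: lb_le_inf.
      by exists (re S c0), c0.
    by move=> _ [c Ac <-]; exact: (zc c Ac).2.
  - by have := ylb c0 Ac0.
  - exact: mreal.
rewrite /infimum ifF; last by apply/eqP => /seteqP[+ _] => /(_ c0%:E); apply; exists c0.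
by rewrite (xget_subset1 _ infm)//; exact: is_subset1_infimums.
Qed.

End Infimum.

Section BoundedCase.
Variables (R : realType) (K : numFieldType) (S : real_form R K).
Variable (X : normedModType K).
Local Notation nr := (nr S).
Local Notation emb := (emb S).
Local Notation re := (re S).
Local Notation imu := (imu S).

Lemma klin_real_bound (l : X -> K) (m : R) : klin l ->
  (forall x, nr x <= 1 -> `|re (l x)| <= m) -> dual_bd S (m + m) l.
Proof.
move=> ll lm; split => //; apply: homogeneous_bound => [c x|x x1].
  exact: klinZ.
rewrite (le_trans (nr_decomp S _))// lerD ?lm//.
rewrite -(klinZ ll) lm// nrZ (le_trans _ x1)// ler_piMl ?nr_ge0//.
exact: nr_imu.
Qed.

Hypothesis hX : K_space X.

Lemma real_delta_affine_approx : exists2 C : R, 0 <= C &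
  forall d (r : X -> R), real_delta_affine S d r -> r 0 = 0 ->
  exists2 l : X -> K, klin l & forall x, nr x <= 1 -> `|r x - re (l x)| <= C * d.
Proof.
have [C C0 CP] := K_space_uniform S hX.
exists (C * 132 + 42) => [|d r rd r0]; first by rewrite addr_ge0 ?mulr_ge0.
have [F [hF qF rF]] := homogenize rd r0.
have [l ll lF] := CP _ _ (conj hF qF : quasi S (132 * d) F).
exists l => // x x1.
have d0 : 0 <= d.
  have nr00 : nr (0 : X) <= 1 by rewrite nr0 ler01.
  by apply: le_trans (rd _ _ 0 nr00 nr00 _); rewrite ?lexx ?ler01.
have -> : r x - re (l x) = re (F x - l x) + (r x - re (F x)) by rewrite reB; ring.
rewrite (le_trans (ler_normD _ _))// mulrDl lerD ?rF//.
rewrite (le_trans (norm_re_le _ _))// (le_trans (lF x))// mulrA.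
by rewrite ler_piMr// !mulr_ge0.
Qed.

Variable W : set X.
Hypothesis cW : compact (W : set (weak_space X)).
Hypothesis dW : dense (linear_span W).

(** Approximating each coordinate by some [l n] spoils convergence to zero. But as
  the coordinates converge to zero, the cluster functionals of [l] have real
  parts at most the approximation error on the ball. Subtracting those provided
  by [cluster_correction] restores convergence and only doubles the error. *)
Lemma real_null_approx : exists2 C : R, 0 <= C &
  forall (d m : R) (r : nat -> X -> R), (forall n, real_delta_affine S d (r n)) ->
  (forall n, r n 0 = 0) -> (forall n x, nr x <= 1 -> `|r n x| <= m) ->
  (forall x, nr x <= 1 -> vanishing S (fun n => emb (r n x))) ->
  exists phi : nat -> X -> K, [/\ forall n, klin (phi n),
    forall x, vanishing S (phi ^~ x) &
    forall n x, nr x <= 1 -> `|r n x - re (phi n x)| <= C * d].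
Proof.
have [C C0 CP] := real_delta_affine_approx.
exists (C + C) => [|d m r rd r0 rm rv]; first by rewrite addr_ge0.
have /choice[l lP] : forall n, exists l : X -> K, klin l /\
    forall x, nr x <= 1 -> `|r n x - re (l x)| <= C * d.
  by move=> n; have [l ll lr] := CP _ _ (rd n) (r0 n); exists l.
pose M := (m + C * d) + (m + C * d).
have lM n : dual_bd S M (l n).
  apply: klin_real_bound => [|x x1]; first exact: (lP n).1.
  have -> : re (l n x) = r n x - (r n x - re (l n x)) by ring.
  by rewrite (le_trans (ler_normB _ _))// lerD ?rm ?(lP n).2.
have [b [bcl bl]] := cluster_correction cW dW lM.
exists (fun n x => -1 * b n x + l n x); split.
- move=> n; apply: klin_comb; last exact: (lP n).1.
  by have [] := cluster_functional_dual lM (bcl n).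
- by move=> x e e0; apply: sub_finite_set (bl x e e0) => n /=; rewrite mulN1r addrC.
move=> n x x1; have -> : r n x - re (-1 * b n x + l n x) =
    (r n x - re (l n x)) + re (b n x) by rewrite mulN1r reD reN; ring.
rewrite mulrDl.
rewrite (le_trans (ler_normD _ _))// lerD ?(lP n).2//.
have [U [UU Uf lim]] := bcl n; have PU : ProperFilter U by case: UU.
apply/ler_addgt0Pr => e e0; have e20 : 0 < e / 2 by rewrite divr_gt0.
have /= [k [kr kb]] := filter_ex (filterI (Uf _ (rv x x1 _ e20)) (lim x _ e20)).
have {kr}kr : `|r k x| < e / 2.
  by move/negP: kr; rewrite -ltNge nr_emb.
have {kb}kb : `|re (l k x - b n x)| < e / 2.
  by apply: le_lt_trans kb; exact: norm_re_le.
have -> : re (b n x) = r k x - (r k x - re (l k x)) - re (l k x - b n x).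
  by rewrite reB; ring.
have := (lP k).2 x x1.
move: kr kb; rewrite !ltr_norml !ler_norml; lra.
Qed.

Lemma A0_const_fin_num : A0_const (unit_ball X) (c0 K) \is a fin_num.
Proof.
have [C C0 CP] := real_null_approx.
apply: (infimum_fin_num S); last by move=> c [].
exists (emb (C + C)); split; first by rewrite emb_ge0 addr_ge0.
move=> delta f delta0 [m fm] fd.
have ball0 : unit_ball X 0 by rewrite /unit_ball /= normr0.
have ballE (x : X) : nr x <= 1 -> unit_ball X x.
  by rewrite /unit_ball /= -nr_le rmorph1.
pose d := re delta; have dE : delta = emb d by rewrite /d emb_re_ge0.
have m0 : 0 <= m by apply: le_trans (fm _ ball0).
have mE : m = emb (re m) by rewrite emb_re_ge0.
have fmn x n : nr x <= 1 -> nr ((f x - f 0 : c0 K) n) <= re m + re m.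
  move=> x1; rewrite (le_trans (c0_coord _ _ _))// (le_trans (nrB _ _ _))//.
  by rewrite lerD// -nr_le -mE fm//; exact: ballE.
(* Real and imaginary parts are approximated separately, with [c] equal to [1]
   and to [imu]. *)
have rew (c : K) (nc : nr c <= 1) : exists phi : nat -> X -> K,
    [/\ forall n, klin (phi n), forall x, vanishing S (phi ^~ x) &
    forall n x, nr x <= 1 ->
      `|re (c * (f x - f 0 : c0 K) n) - re (phi n x)| <= C * d].
  have re_c z : `|re (c * z)| <= nr z.
    by rewrite (le_trans (norm_re_le _ _))// nrM ler_piMl ?nr_ge0.
  apply: (CP d (re m + re m) (fun n x => re (c * (f x - f 0 : c0 K) n))).
  - move=> n x y t x1 y1 t01.
    have t01' : 0 <= emb t <= 1.
      by rewrite -(rmorph1 emb) emb_ge0 ler_emb.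
    have := fd x y (emb t) (ballE _ x1) (ballE _ y1) t01'.
    rewrite dE nr_le => /(le_trans (c0_coord _ _ n)).
    rewrite -(rmorph1 emb) -rmorphB /= => H; apply: le_trans (H).
    set z := emb t *: x + _.
    have -> : re (c * (f z - f 0 : c0 K) n) - t * re (c * (f x - f 0 : c0 K) n) -
      (1 - t) * re (c * (f y - f 0 : c0 K) n) =
      re (c * (f z - emb t *: f x - emb (1 - t) *: f y : c0 K) n).
      rewrite -!re_embM -!reB; congr re.
      have E2 a b (u v w : c0 K) : (u - a *: v - b *: w) n = u n - a * v n - b * w n by [].
      have E w : (f w - f 0 : c0 K) n = f w n - f 0 n by [].
      by rewrite !E E2 rmorphB rmorph1; ring.
    exact: re_c.
  - by move=> n; rewrite subrr; have -> : (0 : c0 K) n = 0 by []; rewrite mulr0 re0.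
  - by move=> n x x1; rewrite (le_trans (re_c _))// fmn.
  - move=> x x1; apply: vanishing_le (ltr01) _ (c0_vanishing S (f x - f 0)) => n.
    by rewrite nr_emb mul1r.
have [|p [pl pv pr]] := rew 1; first by rewrite nr1.
have [|q [ql qv qr]] := rew imu; first exact: nr_imu.
pose a0 x n := emb (re (p n x)) - imu * emb (re (q n x)).
have /choice[a aE] : forall x, exists u : c0 K, forall n, u n = a0 x n.
  move=> x; apply: (@vanishing_c0 _ _ S).
  have e1 (u : nat -> K) : vanishing S u -> vanishing S (fun n => emb (re (u n))).
    by apply: (vanishing_le ltr01) => n; rewrite nr_emb mul1r norm_re_le.
  have := vanishingD (- imu) (e1 _ (qv x)) (e1 _ (pv x)).
  by congr vanishing; apply/funext => n; rewrite /a0; ring.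
exists (fun x => a x + f 0).
  move=> x y t _ _ t01; rewrite (_ : _ - _ = 0) ?normr0//.
  apply/val_inj/funext => n /=.
  have [s tE] : exists s, t = emb s.
    by exists (re t); rewrite emb_re_ge0//; case/andP: t01.
  have key z w : re (t * z + (1 - t) * w) = s * re z + (1 - s) * re w.
    by rewrite tE -(rmorph1 emb) -rmorphB reD !re_embM.
  have E : (a (t *: x + (1 - t) *: y) + f 0 - t *: (a x + f 0) -
    (1 - t) *: (a y + f 0) : c0 K) n =
    a (t *: x + (1 - t) *: y) n + f 0 n - t * (a x n + f 0 n) -
    (1 - t) * (a y n + f 0 n) by [].
  rewrite [LHS]E !aE /a0.
  rewrite (klinD (pl n)) !(klinZ (pl n)) (klinD (ql n)) !(klinZ (ql n)).
  rewrite !key !rmorphD !rmorphM !rmorphB !rmorph1 -tE /=.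
  by rewrite -[RHS](subrr (f 0 n)); ring.
move=> x x1; rewrite dE -rmorphM nr_le; apply: c0_le => n.
have nx1 : nr x <= 1 by move: x1; rewrite /unit_ball /= -(rmorph1 emb) nr_le.
have E : (f x - (a x + f 0) : c0 K) n = (f x - f 0 : c0 K) n - a x n.
  have -> : (f x - (a x + f 0) : c0 K) n = f x n - (a x n + f 0 n) by [].
  have -> : (f x - f 0 : c0 K) n = f x n - f 0 n by [].
  by ring.
rewrite E aE {1}(re_decomp S ((f x - f 0 : c0 K) n)) /a0.
set v := (f x - f 0 : c0 K) n.
have -> : emb (re v) - imu * emb (re (imu * v)) -
  (emb (re (p n x)) - imu * emb (re (q n x))) =
  emb (re (1 * v) - re (p n x)) - imu * emb (re (imu * v) - re (q n x)).
  by rewrite mul1r !rmorphB /=; ring.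
rewrite (le_trans (nrB _ _ _))// mulrDl lerD//; first by rewrite nr_emb pr.
by rewrite (le_trans (nr_imuM _ _))// nr_emb qr.
Qed.

End BoundedCase.

(** * Hahn-Banach separation and nonseparable spaces *)

Section HahnBanach.
Variables (R : realType) (K : numFieldType) (S : real_form R K).
Variable (X : normedModType K).
Local Notation nr := (nr S).
Local Notation emb := (emb S).
Local Notation re := (re S).
Local Notation imu := (imu S).
Implicit Types (p q : X -> R) (x y : X) (t : R).

Section InfIm.
Variables (I : Type) (A : set I) (f : I -> R) (m : R).
Hypothesis fm : forall i, A i -> m <= f i.

Lemma inf_im_le i : A i -> inf (f @` A) <= f i.
Proof.
move=> Ai; apply: ge_inf; last by exists i.
by exists m => _ [j Aj <-]; exact: fm.
Qed.

Lemma le_inf_im c : A !=set0 -> (forall i, A i -> c <= f i) -> c <= inf (f @` A).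
Proof.
move=> [i Ai] fc; apply: lb_le_inf; first by exists (f i), i.
by move=> _ [j Aj <-]; exact: fc.
Qed.

End InfIm.

Lemma inf_im_add (I1 I2 I3 : Type) (A1 : set I1) (A2 : set I2) (A3 : set I3)
    (f1 : I1 -> R) (f2 : I2 -> R) (f3 : I3 -> R) (m : R) :
  (forall k, A3 k -> m <= f3 k) -> A1 !=set0 -> A2 !=set0 ->
  (forall i j, A1 i -> A2 j -> exists2 k, A3 k & f3 k <= f1 i + f2 j) ->
  inf (f3 @` A3) <= inf (f1 @` A1) + inf (f2 @` A2).
Proof.
move=> f3m n1 n2 f123.
rewrite -lerBlDl; apply: le_inf_im => // j Aj.
rewrite lerBlDl -lerBlDr; apply: le_inf_im => // i Ai.
rewrite lerBlDr; have [k Ak fk] := f123 i j Ai Aj.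
exact: le_trans (inf_im_le f3m Ak) fk.
Qed.

Definition sublinear p := (forall x y, p (x + y) <= p x + p y) /\
  forall t x, 0 < t -> p (emb t *: x) <= t * p x.

Lemma emb_scaleK t x : t != 0 -> emb t^-1 *: (emb t *: x) = x.
Proof. by move=> t0; rewrite scalerA -rmorphM mulVf// rmorph1 scale1r. Qed.

Lemma sublinearZ p t x : sublinear p -> 0 < t -> p (emb t *: x) = t * p x.
Proof.
move=> [_ pZ] t0; apply/le_anti; rewrite pZ//=.
have tn0 : t != 0 by rewrite gt_eqF.
have := pZ t^-1 (emb t *: x); rewrite invr_gt0 emb_scaleK// => /(_ t0).
by rewrite -(ler_pM2l t0) mulrA divff// mul1r.
Qed.

Lemma sublinear0 p : sublinear p -> p 0 = 0.
Proof.
move=> ps; have := sublinearZ 0 ps (ltr0n R 2); rewrite scaler0.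
by lra.
Qed.

Lemma sublinearN p x : sublinear p -> - p (- x) <= p x.
Proof.
move=> ps; have [pD _] := ps; have := pD x (- x).
by rewrite subrr sublinear0//; lra.
Qed.

(** The largest sublinear function below [p] whose value at [- y] is at most
  [- p y]. *)
Definition shift p y x :=
  inf [set p (x + emb t *: y) - t * p y | t in [set t | 0 <= t]].

Let nneg0 : [set t : R | 0 <= t] !=set0.
Proof. by exists 0; rewrite /= lexx. Qed.

Section Shift.
Variables (p : X -> R) (y : X).
Hypothesis ps : sublinear p.

Let shift_lb x t : 0 <= t -> - p (- x) <= p (x + emb t *: y) - t * p y.
Proof.
move=> t0; have [pD _] := ps.
have := pD (x + emb t *: y) (- x); rewrite addrAC subrr add0r.
move: t0; rewrite le_eqVlt => /predU1P[<-|t0].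
  rewrite rmorph0 scale0r addr0 mul0r subr0 => _; exact: sublinearN.
by rewrite sublinearZ//; lra.
Qed.

Lemma shift_le x t : 0 <= t -> shift p y x <= p (x + emb t *: y) - t * p y.
Proof. by move=> t0; exact: (inf_im_le (@shift_lb x)). Qed.

Lemma shift_sublinear : sublinear (shift p y).
Proof.
have [pD pZ] := ps; split=> [x z|t x t0].
  apply: (inf_im_add (@shift_lb (x + z))) => // s t /= s0 t0.
  exists (s + t); first by rewrite /= addr_ge0.
  rewrite rmorphD /= scalerDl addrACA.
  have := pD (x + emb s *: y) (z + emb t *: y); lra.
have tn0 : t != 0 by rewrite gt_eqF.
rewrite -ler_pdivrMl//; apply: le_inf_im => // s /= s0.
rewrite ler_pdivrMl//.
have := @shift_le (emb t *: x) (t * s) (mulr_ge0 (ltW t0) s0).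
rewrite rmorphM -scalerA -scalerDr => /le_trans; apply.
have := pZ t (x + emb s *: y) t0; lra.
Qed.

End Shift.

(** By Zorn's lemma there is a minimal sublinear [q] below [p]. Shifting [q] along
  [y] gives a smaller sublinear function, hence [q] again, and this makes [q]
  additive. No subspace of [X] occurs, so the argument applies as it is to the
  real structure underlying a complex space. *)
Lemma sublinear_minimal p : sublinear p -> exists q,
  [/\ forall x, q x <= p x, forall x y, q (x + y) = q x + q y &
      forall t x, q (emb t *: x) = t * q x].
Proof.
move=> ps; pose T := {q : X -> R | sublinear q /\ forall x, q x <= p x}.
pose below (q r : T) := `[< forall x, sval r x <= sval q x >].
have [||A tot|[q [qs qp]] qmin] :=
  @ZL_preorder T (exist _ p (conj ps (fun x => lexx _))) below.
- by move=> q; apply/asboolP.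
- move=> r q s /asboolP qr /asboolP sq; apply/asboolP => x.
  exact: le_trans (sq x) (qr x).
- have [[q0 Aq0]|A0] := pselect (A !=set0); last first.
    exists (exist _ p (conj ps (fun x => lexx _))) => q Aq.
    by exfalso; apply: A0; exists q.
  pose f x (q : T) := sval q x.
  have flb x (q : T) : A q -> - p (- x) <= f x q.
    move=> _; case: q => q [qs qp] /=; rewrite /f /=.
    by have := sublinearN x qs; have := qp (- x); lra.
  pose g x := inf (f x @` A).
  have gs : sublinear g.
    split=> [x y|t x t0].
      apply: (inf_im_add (@flb (x + y))); [by exists q0|by exists q0|].
      move=> q r Aq Ar; have qD (s : T) := (svalP s).1.1 x y.
      have [/asboolP qr|/asboolP rq] := tot q r Aq Ar.
        by exists r => //; rewrite (le_trans (qD r))// lerD2r.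
      by exists q => //; rewrite (le_trans (qD q))// lerD2l.
    rewrite -ler_pdivrMl//; apply: le_inf_im; first by exists q0.
    move=> q Aq; rewrite ler_pdivrMl//.
    apply: le_trans (inf_im_le (@flb _) Aq) _.
    exact: (svalP q).1.2.
  have gq (q : T) x : A q -> g x <= sval q x.
    by move=> Aq; exact: (inf_im_le (@flb x) Aq).
  have gp x : g x <= p x by exact: le_trans (gq q0 x Aq0) ((svalP q0).2 x).
  by exists (exist _ g (conj gs gp)) => q Aq; apply/asboolP => x; exact: gq.
have qD x y : q (x + y) = q x + q y.
  apply/le_anti; rewrite qs.1/=.
  have ss : sublinear (shift q y) /\ forall x, shift q y x <= p x.
    split=> [|z]; first exact: shift_sublinear.
    apply: le_trans (qp z); have := shift_le y qs z (lexx 0).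
    by rewrite rmorph0 scale0r addr0 mul0r subr0.
  have /asboolP/(_ x) /= : below (exist _ (shift q y) ss) (exist _ q (conj qs qp)).
    apply: qmin; apply/asboolP => z /=; have := shift_le y qs z (lexx 0).
    by rewrite rmorph0 scale0r addr0 mul0r subr0.
  have := shift_le y qs x ler01; rewrite rmorph1 scale1r mul1r; lra.
have qN x : q (- x) = - q x.
  by have := qD x (- x); rewrite subrr sublinear0//; lra.
exists q; split => // t x; have [t0|t0|->] := ltgtP t 0.
- have := sublinearZ x qs (t := - t); rewrite oppr_gt0 => /(_ t0).
  by rewrite rmorphN scaleNr qN; lra.
- exact: sublinearZ.
- by rewrite rmorph0 scale0r mul0r sublinear0.
Qed.

Lemma complexify q : (forall x y, q (x + y) = q x + q y) ->
  (forall t x, q (emb t *: x) = t * q x) ->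
  klin (fun x => emb (q x) - imu * emb (q (imu *: x))).
Proof.
move=> qD qZ a x y.
have aE := re_decomp S a; set s := re a in aE; set t := re _ in aE.
have qN z : q (- z) = - q z.
  have := qZ (-1) z; rewrite rmorphN rmorph1 scaleN1r mulN1r; exact.
have aZ z : a *: z = emb s *: z - emb t *: (imu *: z).
  by rewrite scalerA -scalerBl {1}aE [emb t * _]mulrC.
have qa z : q (a *: z) = s * q z - t * q (imu *: z).
  by rewrite aZ qD qN !qZ.
rewrite scalerDr !qD scalerA [imu * a]mulrC -scalerA !qa.
rewrite scalerA; case: (imu_cases S) => [i0|ii].
  have q00 : q 0 = 0 by have := qZ 0 0; rewrite scaler0 mul0r.
  rewrite i0 in aE *; rewrite aE mul0r !scale0r q00; ring.
rewrite ii scaleN1r qN {1}aE.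
set Q := q x; set P := q (imu *: x).
have -> : (emb s - imu * emb t) * (emb Q - imu * emb P) =
  emb s * emb Q - imu * (emb s * emb P + emb t * emb Q) +
  (imu * imu) * (emb t * emb P) by ring.
by rewrite ii; ring.
Qed.

Lemma complexify_re q x : re (emb (q x) - imu * emb (q (imu *: x))) = q x.
Proof. by rewrite reB re_imu_emb re_emb subr0. Qed.

(** The distance [p] to [V] is sublinear, and a minimal sublinear function below
  [shift p x0] is additive and equals [p x0] at [x0]. *)
Lemma hahn_banach_separation (V : set X) x0 (e : R) : V 0 ->
  (forall a u v, V u -> V v -> V (a *: u + v)) -> 0 < e ->
  (forall v, V v -> e <= nr (x0 - v)) ->
  exists phi, [/\ dual_bd S 2 phi, forall v, V v -> phi v = 0 & phi x0 <> 0].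
Proof.
move=> V0 VD e0 Ve; pose p x := inf [set nr (x - v) | v in V].
have Vn : V !=set0 by exists 0.
have plb x v : V v -> 0 <= nr (x - v) by move=> _; exact: nr_ge0.
have ps : sublinear p.
  split=> [x y|t x t0].
    apply: (inf_im_add (@plb (x + y))) => // u v Vu Vv.
    exists (u + v); first by have := VD 1 _ _ Vu Vv; rewrite scale1r.
    by rewrite opprD addrACA nrD.
  rewrite -ler_pdivrMl//; apply: le_inf_im => // v Vv.
  rewrite ler_pdivrMl//; have Vtv : V (emb t *: v).
    by have := VD (emb t) _ _ Vv V0; rewrite addr0.
  apply: le_trans (inf_im_le (@plb _) Vtv) _.
  by rewrite -scalerBr nrZ nr_emb gtr0_norm.
have p_nr x : p x <= nr x.
  by have := inf_im_le (@plb x) V0; rewrite subr0.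
have pV v : V v -> p v <= 0.
  by move=> Vv; have := inf_im_le (@plb v) Vv; rewrite subrr nr0.
have px0 : e <= p x0 by apply: le_inf_im.
have [q [qs qD qZ]] := sublinear_minimal (shift_sublinear x0 ps).
have qp x : q x <= p x.
  rewrite (le_trans (qs x))//; have := shift_le x0 ps x (lexx 0).
  by rewrite rmorph0 scale0r addr0 mul0r subr0.
have qN x : q (- x) = - q x.
  by have := qZ (-1) x; rewrite rmorphN rmorph1 scaleN1r mulN1r.
have qx0 : 0 < q x0.
  have := qs (- x0); have := shift_le x0 ps (- x0) ler01.
  by rewrite rmorph1 scale1r addNr sublinear0// mul1r qN; lra.
have qV v : V v -> q v = 0.
  move=> Vv; have VNv : V (- v) by have := VD (-1) _ _ Vv V0; rewrite scaleN1r addr0.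
  have := le_trans (qp _) (pV _ Vv); have := le_trans (qp _) (pV _ VNv).
  by rewrite qN; lra.
have q_nr x : `|q x| <= nr x.
  rewrite ler_norml (le_trans (qp x) (p_nr x)) andbT.
  by have := le_trans (qp (- x)) (p_nr (- x)); rewrite qN nrN; lra.
exists (fun x => emb (q x) - imu * emb (q (imu *: x))); split.
- split=> [|x]; first exact: complexify.
  rewrite (le_trans (nrB _ _ _))// mulr_natl mulr2n lerD ?nr_emb//.
  rewrite (le_trans (nr_imuM _ _))// nr_emb (le_trans (q_nr _))//.
  by rewrite nrZ ler_piMl ?nr_ge0 ?nr_imu.
- move=> v Vv; rewrite !qV ?rmorph0 ?mulr0 ?subrr//.
  by have := VD imu _ _ Vv V0; rewrite addr0.
move=> /(congr1 re); rewrite complexify_re re0 => q0.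
by move: qx0; rewrite q0 ltxx.
Qed.

Lemma rat_approx (z : K) (e : R) : 0 < e ->
  exists a b : rat, nr (z - (emb (ratr a) - imu * emb (ratr b))) < e.
Proof.
move=> e0; have e20 : 0 < e / 2 by rewrite divr_gt0.
have ra (r : R) : exists a : rat, `|r - ratr a| < e / 2.
  have re2 : r < r + e / 2 by rewrite ltrDl.
  have [a] := rat_in_itvoo re2; rewrite in_itv /= => /andP[ra1 ra2].
  by exists a; rewrite ltr_norml; lra.
have [a za] := ra (re z); have [b zb] := ra (re (imu * z)).
exists a, b; rewrite {1}(re_decomp S z).
have -> : emb (re z) - imu * emb (re (imu * z)) - (emb (ratr a) - imu * emb (ratr b)) =
  emb (re z - ratr a) - imu * emb (re (imu * z) - ratr b).
  by rewrite !rmorphB /=; ring.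
rewrite (le_lt_trans (nrB _ _ _))// [ltRHS]splitr ltrD ?nr_emb//.
by rewrite (le_lt_trans (nr_imuM _ _))// nr_emb.
Qed.

Let comb (d : nat -> X) (s : seq (K * nat)) := \sum_(c <- s) c.1 *: d c.2.

Let rcomb (d : nat -> X) (s : seq (rat * rat * nat)) :=
  comb d [seq (emb (ratr c.1.1) - imu * emb (ratr c.1.2), c.2) | c <- s].

Let comb_approx d s (e : R) : 0 < e -> exists s', nr (comb d s - rcomb d s') < e.
Proof.
elim: s e => [|[z n] s IH] e e0.
  by exists [::]; rewrite /rcomb /comb /= subrr nr0.
have e20 : 0 < e / 2 by rewrite divr_gt0.
have [s' ss'] := IH _ e20.
have dn1 : 0 < nr (d n) + 1 by rewrite ltr_wpDl ?nr_ge0.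
have [a [b zab]] := rat_approx z (divr_gt0 e20 dn1).
exists ((a, b, n) :: s'); rewrite /rcomb /comb /= !big_cons /=.
rewrite opprD addrACA -scalerBl (le_lt_trans (nrD _ _ _))// [ltRHS]splitr.
rewrite ler_ltD// nrZ; move/ltW: zab; rewrite ler_pdivlMr// => /(le_trans _); apply.
by rewrite ler_wpM2l ?nr_ge0// lerDl.
Qed.

(** Otherwise the combinations of the [d n] with rational coefficients would be
  dense. *)
Lemma nonseparable_annihilator (d : nat -> X) : ~ separable X ->
  exists phi, [/\ dual_bd S 2 phi, forall n, phi (d n) = 0 & exists x, phi x <> 0].
Proof.
move=> nsep; pose V := range (comb d).
have V0 : V 0 by exists [::]; rewrite /comb ?big_nil.
have VD a u v : V u -> V v -> V (a *: u + v).
  move=> [s _ <-] [s' _ <-]; exists ([seq (a * c.1, c.2) | c <- s] ++ s') => //.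
  rewrite /comb big_cat big_map /= scaler_sumr; congr (_ + _).
  by apply: eq_bigr => c _; rewrite scalerA.
have Vd n : V (d n) by exists [:: (1, n)]; rewrite /comb ?big_seq1 /= ?scale1r.
suff [x0 [e [e0 Ve]]] : exists x0 (e : R), 0 < e /\ forall v, V v -> e <= nr (x0 - v).
  have [phi [phi_b phiV phix]] := hahn_banach_separation V0 VD e0 Ve.
  by exists phi; split => // [n|]; [exact: phiV|exists x0].
apply: contrapT => nx; apply: nsep; exists (range (rcomb d)).
  exact: card_le_trans (card_image_le _ _) (countableP _).
move=> O [x Ox] Oop; have /nbhs_ballP[e /= e0 eO] := open_nbhs_nbhs (conj Oop Ox).
have eE : emb (re e) = e by rewrite emb_re_ge0// ltW.
have {}e0 : 0 < re e by rewrite -(emb_gt0 S) eE.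
have e20 : 0 < re e / 2 by rewrite divr_gt0.
have [_ [[s _ <-] xs]] : exists v, V v /\ nr (x - v) < re e / 2.
  apply: contrapT => nv; apply: nx; exists x, (re e / 2); split => // v Vv.
  by rewrite leNgt; apply/negP => xv; apply: nv; exists v.
have [s' ss'] := comb_approx d s e20.
exists (rcomb d s'); split; last by exists s'.
apply: eO; rewrite -ball_normE /= -eE nr_lt.
have -> : x - rcomb d s' = (x - comb d s) + (comb d s - rcomb d s').
  by rewrite addrA subrK.
by rewrite (le_lt_trans (nrD _ _ _))// [ltRHS]splitr ltrD.
Qed.

End HahnBanach.

(** * An uncountable family of functionals, null at each point *)

Section WellFounded.

Lemma well_order_exists (T : eqType) : exists lt : T -> T -> Prop,
  well_founded lt /\ forall s t, [\/ lt s t, s = t | lt t s].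
Proof.
have [r rwo] := well_ordering_principle T.
have min (A : {pred T}) : (exists x, x \in A) -> exists z, z \in A /\ forall x, x \in A -> r z x.
  by move=> /rwo[z [[Az lz] _]]; exists z.
have tot s t : r s t \/ r t s.
  have [|z [+ zl]] := min [pred x | (x == s) || (x == t)].
    by exists s; rewrite inE eqxx.
  rewrite inE => /orP[/eqP zs|/eqP zt].
    by left; rewrite -zs; apply: zl; rewrite inE eqxx orbT.
  by right; rewrite -zt; apply: zl; rewrite inE eqxx.
exists (fun s t => ~~ r t s); split=> [t|s t].
  apply: contrapT => nt.
  have [|z [zA zl]] := min [pred x | `[< ~ Acc (fun s t => ~~ r t s) x >]].
    by exists t; apply/asboolP.
  move: zA => /asboolP; apply; constructor => y rzy.
  apply: contrapT => ny; move/negP: rzy; apply; apply: zl.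
  exact/asboolP.
have [->|st] := eqVneq s t; first exact: Or32.
have [rts|] := boolP (r t s); last by move=> ?; exact: Or31.
have [rst|] := boolP (r s t); last by move=> ?; exact: Or33.
exfalso; move/eqP: st; apply.
have [|z [[Az lz] zu]] := rwo [pred x | (x == s) || (x == t)].
  by exists s; rewrite inE eqxx.
have rss x : r x x by have [] := tot x x.
rewrite -(zu s); first rewrite -(zu t) //.
  by split=> [|y]; rewrite ?inE ?eqxx ?orbT// => /orP[]/eqP->.
by split=> [|y]; rewrite ?inE ?eqxx ?orbT// => /orP[]/eqP->.
Qed.

Variables (T Y : Type) (lt : T -> T -> Prop).
Hypothesis wf : well_founded lt.

Lemma wf_minimal (A : set T) : A !=set0 -> exists2 m, A m & forall s, A s -> ~ lt s m.
Proof.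
move=> [t At]; apply: contrapT => nm; move: At; elim/(well_founded_ind wf): t => t IH At.
by apply: nm; exists t => // s As /IH.
Qed.

Lemma wf_recursion (y0 : Y) (G : T -> (T -> Y) -> Y) :
  (forall t f g, (forall s, lt s t -> f s = g s) -> G t f = G t g) ->
  exists f : T -> Y, forall t, f t = G t f.
Proof.
move=> Gext.
pose H t (rec : forall s, lt s t -> Y) :=
  G t (fun s => if pselect (lt s t) is left st then rec s st else y0).
exists (Fix wf (fun _ => Y) H) => t.
rewrite Fix_eq => [|x f g fg].
  by apply: Gext => s st; case: pselect.
by congr (G x); apply/funext => s; case: pselect.
Qed.

End WellFounded.

Section Cantor.

Lemma cantor_uncountable : ~ countable [set: nat -> bool].
Proof.
move=> /countable_injP[f finj].
pose inv n := xget (fun=> true) [set t : nat -> bool | f t = n].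
pose g n := ~~ inv n n.
have : inv (f g) = g.
  have := @xgetPex _ (fun=> true) [set t | f t = f g] (ex_intro _ g erefl).
  by apply: finj; rewrite inE.
move=> /(congr1 (fun h => h (f g))); rewrite /g.
by case: (inv _ _).
Qed.

End Cantor.

Section NullFamily.
Variables (R : realType) (K : numFieldType) (S : real_form R K).
Variable (X : normedModType K).
Local Notation nr := (nr S).
Hypothesis nonsep : ~ separable X.
Variable W : set X.
Hypothesis cW : compact (W : set (weak_space X)).
Hypothesis dW : dense (linear_span W).

Let dual0 : dual_bd S 2 ((fun=> 0) : X -> K).
Proof.
split=> [a x y|x]; first by rewrite mulr0 addr0.
by rewrite nr0 mulr_ge0 ?nr_ge0.
Qed.

Let net_exists : exists net : seq (X -> K) -> nat -> seq X, forall b k,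
  (forall i, (i < size b)%N -> dual_bd S 2 (nth (fun=> 0) b i)) ->
  (forall x, x \in net b k -> W x) /\
  forall w, W w -> exists2 x, x \in net b k & forall i, (i < size b)%N ->
    nr (nth (fun=> 0) b i w - nth (fun=> 0) b i x) < k.+1%:R^-1.
Proof.
have H b : exists g : nat -> seq X, forall k,
  (forall i, (i < size b)%N -> dual_bd S 2 (nth (fun=> 0) b i)) ->
  (forall x, x \in g k -> W x) /\
  forall w, W w -> exists2 x, x \in g k & forall i, (i < size b)%N ->
    nr (nth (fun=> 0) b i w - nth (fun=> 0) b i x) < k.+1%:R^-1.
  suff /choice[g gP] : forall k, exists s : seq X,
      (forall i, (i < size b)%N -> dual_bd S 2 (nth (fun=> 0) b i)) ->
      (forall x, x \in s -> W x) /\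
      forall w, W w -> exists2 x, x \in s & forall i, (i < size b)%N ->
        nr (nth (fun=> 0) b i w - nth (fun=> 0) b i x) < k.+1%:R^-1.
    by exists g.
  move=> k.
  have [bd|nbd] := pselect (forall i, (i < size b)%N -> dual_bd S 2 (nth (fun=> 0) b i));
    last by exists [::] => /nbd.
  have [|//|s [sW sw]] := @finite_net _ _ S X W cW nat (nth (fun=> 0) b) 2
      (iota 0 (size b)) k.+1%:R^-1.
    by move=> i; rewrite mem_iota /= add0n; exact: bd.
  exists s => _; split => // w Ww; have [x xs xw] := sw w Ww.
  by exists x => // i ib; apply: xw; rewrite mem_iota add0n.
by have [net netP] := choice H; exists net.
Qed.

Let T := nat -> bool.

(** Well-order the index set and choose [psi t] by recursion, nonzero if possible,
  but vanishing on the finite nets for all finite families of earlier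
  functionals. If infinitely many [psi t] were large at [x], so would be
  infinitely many among which each has only finitely many predecessors. A limit
  of these vanishes on all nets for finite families of them, and is therefore
  zero by [determined_eq0], although it is large at [x].
  If only countably many [psi t] were nonzero, the nets involved would form a
  countable set, and [nonseparable_annihilator] would make every choice
  nonzero. *)
Lemma null_family : exists psi : T -> X -> K,
  [/\ forall t, dual_bd S 2 (psi t),
      forall x e, 0 < e -> finite_set [set t | e <= nr (psi t x)] &
      ~ countable [set t | exists x, psi t x <> 0]].
Proof.
have [lt [wf tot]] := well_order_exists T.
have [net netP] := net_exists.
pose good t (f : T -> X -> K) : set (X -> K) := [set phi | [/\ dual_bd S 2 phi,
  exists x, phi x <> 0 & forall b : seq T, (forall s, s \in b -> lt s t) ->
  forall k x, x \in net (map f b) k -> phi x = 0]].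
have [|psi psiE] := @wf_recursion T (X -> K) lt wf (fun=> 0)
    (fun t f => xget (fun=> 0) (good t f)).
  move=> t f g fg; congr (xget _ _); apply/funext => phi; apply/propext.
  have fgb (b : seq T) : (forall s, s \in b -> lt s t) -> map f b = map g b.
    by move=> bt; apply/eq_in_map => s /bt/fg.
  split=> -[h1 h2 h3]; split=> // b bt k x; first by rewrite -fgb//; exact: h3.
  by rewrite fgb//; exact: h3.
have psi_cases t : good t psi (psi t) \/ psi t = fun=> 0.
  rewrite psiE; have [gt|ngt] := pselect (exists phi, good t psi phi).
    by left; exact: xgetPex.
  by right; apply: xgetPN => phi gphi; apply: ngt; exists phi.
have psi_dual t : dual_bd S 2 (psi t) by case: (psi_cases t) => [[]|->].
have psi_net t (b : seq T) k x : (forall s, s \in b -> lt s t) ->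
    x \in net (map psi b) k -> psi t x = 0.
  move=> bt xb; case: (psi_cases t) => [[_ _ van]|-> //]; exact: van bt k x xb.
have netW (b : seq T) k x : x \in net (map psi b) k -> W x.
  have [|nW _] := netP (map psi b) k; last exact: nW.
  by move=> j; rewrite size_map => jb; rewrite (nth_map (fun=> true)).
exists psi; split => // [x e e0|].
  apply: contrapT => infA; set A := [set t | _] in infA.
  have [A' [A'A infA' A'seg]] : exists A' : set T, [/\ A' `<=` A, infinite_set A' &
      forall t, A' t -> finite_set (A' `&` [set s | lt s t])].
    have [nb|ninf] := pselect (exists b, infinite_set (A `&` [set s | lt s b])).
      have [b infb bmin] := @wf_minimal T lt wf [set b | infinite_set (A `&` [set s | lt s b])] nb.
      exists (A `&` [set s | lt s b]); split; [by move=> t []|exact: infb|].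
      move=> t [At tb]; apply: contrapT => inft; apply: (bmin t) => // fint; apply: inft.
      by apply: sub_finite_set fint => s [[]].
    exists A; split; [by []|exact: infA|].
    move=> t At; apply: contrapT => inft; apply: ninf.
    by exists t.
  have [U [UU UA' Uf]] := free_ultrafilter infA'.
  have PU : ProperFilter U by case: UU.
  have [theta lim] := dual_bd_ulim UU psi_dual.
  suff t0 : theta x = 0.
    have : e <= nr (theta x).
      by apply: (ulim_ge UU (lim x)); apply: filterS UA' => t /A'A.
    by rewrite t0 nr0 leNgt e0.
  apply: (determined_eq0 (S := S) cW dW (f := psi) (A := A') (M := 2) (N := 2)
    (D := [set y | exists b k, (forall s, s \in b -> A' s) /\ y \in net (map psi b) k])).
  - by [].
  - exact: (ulim_dual_bd UU psi_dual lim).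
  - by move=> y [b [k [_ /netW]]].
  - move=> w b r Ww bA r0; have [k kr] := invS_lt r0.
    have [|_ /(_ w Ww)[y yb wy]] := netP (map psi b) k.
      by move=> j; rewrite size_map => jb; rewrite (nth_map (fun=> true)).
    exists y; first by exists b, k.
    move=> s sb; apply: lt_trans (kr k (leqnn _)).
    have := wy (index s b); rewrite size_map index_mem => /(_ sb).
    by rewrite (nth_map (fun=> true)) ?index_mem// nth_index.
  - move=> w z wz; apply: (ulim_eq UU (lim w) (lim z)).
    by apply: filterS UA' => t /wz.
  - move=> y [b [k [bA yb]]]; apply: (ulim_eq UU (lim y) (ulim_cst S UU 0)).
    suff Ub : U [set t | forall s, s \in b -> lt s t].
      by apply: filterS Ub => t /= bt; exact: psi_net bt yb.
    elim: b bA {yb} => [_|s b IH bA]; first by apply: filterS filterT.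
    have As : A' s by apply: bA; rewrite mem_head.
    have Ub : U [set t | forall s, s \in b -> lt s t].
      by apply: IH => u ub; apply: bA; rewrite inE ub orbT.
    have fs : finite_set ((A' `&` [set u | lt u s]) `|` [set s]).
      by rewrite finite_setU; split; [exact: A'seg|exact: finite_set1].
    apply: filterS (filterI UA' (filterI Ub (Uf _ fs))) => t [A't [/= bt nt]] u.
    rewrite inE => /predU1P[->|/bt//].
    by have [//|st|ts] := tot s t; exfalso; apply: nt; [right|left].
move=> /countable_injP[f finj].
set Z := [set t | _] in finj.
apply: cantor_uncountable; apply: (@sub_countable _ _ _ Z); last first.
  by apply/countable_injP; exists f.
apply: subset_card_le => t _.
pose r n := if n is m.+1
  then psi (xget (fun=> true) [set t | Z t /\ f t = m]) else fun=> 0.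
have rE s : exists n, psi s = r n.
  have [Zs|nZs] := pselect (Z s); last first.
    by exists 0%N; apply/funext => x; apply: contrapT => sx; apply: nZs; exists x.
  exists (f s).+1; rewrite /r; congr psi; apply/esym.
  apply: xget_unique => // u [Zu fu]; apply: finj; rewrite ?inE//.
(* An enumeration of the points of all nets for finite families of the [psi s]. *)
pose d (n : nat) := let c := odflt ([::], 0%N, 0%N)
    (unpickle n : option (seq nat * nat * nat)%type) in
  nth 0 (net (map r c.1.1) c.1.2) c.2.
have [phi [phi_b phi_d [x phix]]] := nonseparable_annihilator S d nonsep.
have [[_ + _]//|pt0] := psi_cases t.
have good_phi : good t psi phi.
  split => // [|b _ k y yb]; first by exists x.
  have /choice[g gE] := rE.
  have := phi_d (pickle (map g b, k, index y (net (map psi b) k))).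
  rewrite /d pickleK /= -map_comp.
  have -> : map (r \o g) b = map psi b by apply: eq_map => s /=; rewrite gE.
  by rewrite nth_index.
have := @xgetPex _ (fun=> 0) (good t psi) (ex_intro _ phi good_phi).
by rewrite -psiE => -[_ + _]; apply.
Qed.

End NullFamily.

(** * Unbounded functions: the second constant is infinite *)

Section Branches.

(** The branches of the binary tree, as an almost disjoint family of sets of
  natural numbers: [on_branch n t] when [n] codes an initial segment of [t]. *)
Definition on_branch (n : nat) (t : nat -> bool) :=
  exists k, n = pickle (mkseq t k).

Lemma branch_infinite t N : exists2 n, (N <= n)%N & on_branch n t.
Proof.
apply: contrapT => nb.
pose f k := pickle (mkseq t k).
have finj : injective f.
  by move=> i j /(pcan_inj pickleK)/(congr1 size); rewrite !size_mkseq.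
apply: infinite_nat.
apply: sub_finite_set (finite_preimage (f := f) (in2W finj) (finite_II N)) => k _ /=.
by rewrite ltnNge; apply/negP => Nk; apply: nb; exists (f k) => //; exists k.
Qed.

Lemma branch_disjoint s t : s <> t ->
  exists N, forall n, (N <= n)%N -> on_branch n s -> on_branch n t -> False.
Proof.
move=> st; have [i0 sti] : exists i, s i <> t i.
  apply: contrapT => h; apply: st; apply/funext => i.
  by apply: contrapT => sti; apply: h; exists i.
have [N PN] := ltn_seq_bound [seq pickle (mkseq s k) | k <- iota 0 i0.+1].
exists N => n Nn [k nk] [l nl].
have := congr1 id nl; rewrite {1}nk => /(pcan_inj pickleK) kl.
have lk : k = l by have := congr1 size kl; rewrite !size_mkseq.
have [ki|ik] := leqP k i0.
  have := PN n; rewrite ltnNge Nn => /(_ _)/negP; apply => //.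
  by apply/mapP; exists k; rewrite // mem_iota /= add0n ltnS.
apply: sti; have := congr1 (nth true ^~ i0) kl.
by rewrite !nth_mkseq -?lk.
Qed.

Lemma branch_disjoint_finite (E : set (nat -> bool)) : finite_set E ->
  exists N, forall n, (N <= n)%N -> forall s t, E s -> E t ->
    on_branch n s -> on_branch n t -> s = t.
Proof.
move=> /finite_seqP[b ->].
have pair s t : exists N, forall n, (N <= n)%N -> on_branch n s -> on_branch n t -> s = t.
  have [->|st] := pselect (s = t); first by exists 0%N.
  by have [N NP] := branch_disjoint st; exists N => n Nn ns nt; case: (NP n Nn).
have /choice[g gP] : forall p : (nat -> bool) * (nat -> bool), exists N,
    forall n, (N <= n)%N -> on_branch n p.1 -> on_branch n p.2 -> p.1 = p.2.
  by move=> p; exact: pair.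
have [N PN] := ltn_seq_bound [seq g (s, t) | s <- b, t <- b].
exists N => n Nn s t /= sb tb; apply: (gP (s, t)).
by rewrite (leq_trans _ Nn)// ltnW// PN//; apply/allpairsP; exists (s, t).
Qed.

End Branches.

Lemma finite_argmax (T : Type) (R : realType) (A : set T) (g : T -> R) : A !=set0 ->
  (forall e, 0 < e -> finite_set [set t | e <= g t]) -> (forall t, 0 <= g t) ->
  exists2 t, A t & forall s, A s -> g s <= g t.
Proof.
move=> [t0 At0] gfin g0.
have [all0|] := pselect (forall t, A t -> g t = 0).
  by exists t0 => // s As; rewrite (all0 _ As) (all0 _ At0).
move=> /existsNP[t1 /not_implyP[At1 /eqP gt1]].
have {}gt1 : 0 < g t1 by rewrite lt_neqAle eq_sym gt1 g0.
have argmax (B : set T) : finite_set B -> B !=set0 ->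
    exists2 t, B t & forall s, B s -> g s <= g t.
  elim/Pchoice: T => T in A g t0 At0 gfin g0 t1 At1 gt1 B *.
  move=> /finite_seqP[b ->]; elim: b => [[]//|x b IH _].
  have [[y yb]|nb] := pselect ([set` b] !=set0); last first.
    exists x => [|s]; rewrite /= ?mem_head// inE => /predU1P[->//|sb].
    by exfalso; apply: nb; exists s.
  have [|t tb tmax] := IH; first by exists y.
  have [xt|tx] := leP (g x) (g t).
    exists t => [|s] /=; rewrite inE; first by rewrite [t \in b]tb orbT.
    by move=> /predU1P[->//|]; exact: tmax.
  exists x => [|s] /=; rewrite inE ?eqxx// => /predU1P[->//|sb].
  by rewrite (le_trans (tmax s sb))// ltW.
have [||t [At gt] tmax] := argmax (A `&` [set t | g t1 <= g t]).
- by apply: sub_finite_set (gfin _ gt1) => t [].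
- by exists t1; split => /=.
exists t => // s As; have [|st] := leP (g t1) (g s); first by move=> ?; exact: tmax.
by rewrite (le_trans (ltW st)).
Qed.

Section UnboundedCase.
Variables (R : realType) (K : numFieldType) (S : real_form R K).
Variable (X : normedModType K).
Local Notation nr := (nr S).
Local Notation emb := (emb S).
Local Notation re := (re S).
Local Notation imu := (imu S).

Section BranchLift.
Variable psi : (nat -> bool) -> X -> K.
Hypothesis psi_dual : forall t, dual_bd S 2 (psi t).
Hypothesis psi_null : forall x e, 0 < e -> finite_set [set t | e <= nr (psi t x)].

(** A bounded representative, modulo null sequences, of the sum over [t] of
  [psi t x] times the indicator function of the branch [t]. Choosing the branch
  with the largest value is not linear in [x], but bounded by a multiple of its
  norm. *)
Definition branch_lift x n : K := xget 0 [set z | exists t,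
  [/\ on_branch n t, z = psi t x & forall s, on_branch n s -> nr (psi s x) <= nr z]].

Lemma branch_liftP x n : (exists t, on_branch n t) -> exists t,
  [/\ on_branch n t, branch_lift x n = psi t x &
      forall s, on_branch n s -> nr (psi s x) <= nr (psi t x)].
Proof.
move=> nt; have [|||t tn tmax] := @finite_argmax _ R (on_branch n) (fun t => nr (psi t x)).
- by have [t tn] := nt; exists t.
- exact: psi_null.
- by move=> t; exact: nr_ge0.
have [|s [sn sE smax]] := @xgetPex _ 0 [set z | exists t,
  [/\ on_branch n t, z = psi t x & forall s, on_branch n s -> nr (psi s x) <= nr z]].
  by exists (psi t x), t.
by exists s; split => // u un; rewrite -sE; exact: smax.
Qed.

Lemma branch_lift_off x n : ~ (exists t, on_branch n t) -> branch_lift x n = 0.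
Proof. by move=> nt; apply: xgetPN => z [t [tn _ _]]; apply: nt; exists t. Qed.

Lemma branch_lift_bound x n : nr (branch_lift x n) <= 2 * nr x.
Proof.
have [nt|nt] := pselect (exists t, on_branch n t).
  by have [t [_ -> _]] := branch_liftP x nt; case: (psi_dual t).
by rewrite branch_lift_off// nr0 mulr_ge0 ?nr_ge0.
Qed.

Lemma branch_lift0 n : branch_lift 0 n = 0.
Proof.
apply/eqP; rewrite -(nr_eq0 S) eq_le nr_ge0 andbT.
by have := branch_lift_bound 0 n; rewrite nr0 mulr0.
Qed.

(** Finitely many branches carry the functionals that are not small at one of the
  points of [xs]. Sufficiently late nodes lie on at most one of them, and the
  lift follows it. *)
Lemma branch_lift_near (xs : seq X) t0 e : 0 < e -> exists N, forall n, (N <= n)%N ->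
  ((forall x, branch_lift x n = 0) /\ ~ on_branch n t0) \/
  exists t, (on_branch n t0 -> t = t0) /\
    forall x, x \in xs -> nr (branch_lift x n - psi t x) <= 2 * e.
Proof.
move=> e0; have xs_fin : finite_set [set t | exists2 x, x \in xs & e <= nr (psi t x)].
  elim: xs => [|x xs IH]; first by apply: sub_finite_set (finite_set0 _) => t [].
  apply: (@sub_finite_set _ _ ([set t | e <= nr (psi t x)] `|`
    [set t | exists2 x, x \in xs & e <= nr (psi t x)])); last first.
    by rewrite finite_setU; split => //; exact: psi_null.
  by move=> t [y]; rewrite inE => /predU1P[->|yx] te; [left|right; exists y].
pose E := [set t | exists2 x, x \in xs & e <= nr (psi t x)] `|` [set t0].
have Efin : finite_set E.
  by rewrite finite_setU; split; last exact: finite_set1.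
have [N NE] := branch_disjoint_finite Efin; exists N => n Nn.
have [nt|nt] := pselect (exists t, on_branch n t); last first.
  by left; split=> [x|n0]; [exact: branch_lift_off|apply: nt; exists t0].
right; have [t [tn tE]] : exists t, on_branch n t /\
    forall s, on_branch n s -> E s -> s = t.
  have [[t [tn Et]]|nE] := pselect (exists t, on_branch n t /\ E t).
    by exists t; split => // s sn Es; exact: (NE n Nn).
  by have [t tn] := nt; exists t; split => // s sn Es; exfalso; apply: nE; exists s.
exists t; split=> [n0|x xxs]; first by rewrite (tE t0)//; right.
have [s [sn -> smax]] := branch_liftP x nt.
have [Es|nEs] := pselect (E s).
  by rewrite (tE s sn Es) subrr nr0 mulr_ge0// ltW.
have se : nr (psi s x) < e.
  by rewrite ltNge; apply/negP => h; apply: nEs; left; exists x.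
rewrite (le_trans (nrB _ _ _))// mulr_natl mulr2n lerD ?(ltW se)//.
exact: le_trans (smax t tn) (ltW se).
Qed.

Lemma branch_lift_linear a x y : vanishing S
  (fun n => branch_lift (a *: x + y) n - (a * branch_lift x n + branch_lift y n)).
Proof.
move=> e e0; pose c := nr a + 3.
have c0 : 0 < c by rewrite ltr_wpDl ?nr_ge0.
have d0 : 0 < e / (2 * c) by rewrite divr_gt0 ?mulr_gt0.
have [N NP] := branch_lift_near [:: a *: x + y; x; y] (fun=> true) d0.
apply/finite_nat_bound; exists N => n Nn /=; apply/negP; rewrite -ltNge.
have [[n0 _]|[t [_ nt]]] := NP n Nn.
  by rewrite !n0 mulr0 addr0 subrr nr0.
have h1 := nt (a *: x + y) (mem_head _ _).
have h2 := nt x; rewrite !inE eqxx orbT in h2; have {}h2 := h2 isT.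
have h3 := nt y; rewrite !inE eqxx !orbT in h3; have {}h3 := h3 isT.
have -> : branch_lift (a *: x + y) n - (a * branch_lift x n + branch_lift y n) =
  (branch_lift (a *: x + y) n - psi t (a *: x + y)) -
  a * (branch_lift x n - psi t x) - (branch_lift y n - psi t y).
  by have [tl _] := psi_dual t; rewrite tl; ring.
set d := 2 * (e / (2 * c)) in h1 h2 h3.
have dE : d * c = e by rewrite /d; field; rewrite gt_eqF.
have d1 : 0 < d by rewrite mulr_gt0.
apply: (@le_lt_trans _ _ (d + nr a * d + d)).
  rewrite (le_trans (nrB _ _ _))// lerD// (le_trans (nrB _ _ _))// lerD// nrM.
  by rewrite ler_wpM2l ?nr_ge0.
by rewrite -dE /c; lra.
Qed.

End BranchLift.

Variable W : set X.
Hypothesis cW : compact (W : set (weak_space X)).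
Hypothesis dW : dense (linear_span W).
Hypothesis nonsep : ~ separable X.

Lemma affine_klin (r : X -> R) (m : R) : real_delta_affine S 0 r -> r 0 = 0 ->
  (forall x, nr x <= 1 -> `|r x| <= m) ->
  exists2 F : X -> K, dual_bd S (m + m) F & forall x, nr x <= 1 -> re (F x) = r x.
Proof.
move=> rd r0 rm; have [F [hF qF rF]] := homogenize rd r0.
have rFE x : nr x <= 1 -> re (F x) = r x.
  by move=> /rF; rewrite mulr0 normr_le0 subr_eq0 => /eqP.
exists F => //; apply: klin_real_bound => [a x y|x x1]; last by rewrite rFE ?rm.
apply/eqP; rewrite -subr_eq0 -hF opprD addrA -(nr_eq0 S) eq_le nr_ge0 andbT.
by rewrite (le_trans (qF _ _))// mulr0 mul0r.
Qed.

(** Such functionals [F n] would tend to [psi t] along the branch [t], so that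
  every [psi t] would be determined by the values of all [F n]. By
  [determined_eq0] it would then be zero as soon as it vanishes on the countable
  union of the nets for [F], and all but countably many [psi t] do. *)
Lemma branch_lift_not_liftable (psi : (nat -> bool) -> X -> K) (F : nat -> X -> K) (M : R) :
  (forall t, dual_bd S 2 (psi t)) ->
  (forall x e, 0 < e -> finite_set [set t | e <= nr (psi t x)]) ->
  ~ countable [set t | exists x, psi t x <> 0] ->
  (forall n, dual_bd S M (F n)) ->
  ~ forall x, nr x <= 1 -> vanishing S (fun n => emb (re (F n x - branch_lift psi x n))).
Proof.
move=> psi_dual psi_null unc FM lift.
have re_psi t y : nr y <= 1 -> (forall n, F n y = 0) -> re (psi t y) = 0.
  move=> y1 Fy; apply/eqP; rewrite -normr_eq0 eq_le normr_ge0 andbT.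
  apply/ler_addgt0Pr => e e0; rewrite add0r.
  have e30 : 0 < e / 3 by rewrite divr_gt0.
  have [N NP] := branch_lift_near psi_null [:: y] t e30.
  have /finite_nat_bound[N' N'P] := lift y y1 _ e30.
  have [n Nn tn] := branch_infinite t (maxn N N').
  have := N'P n (leq_trans (leq_maxr _ _) Nn); move/negP; rewrite -ltNge nr_emb Fy sub0r.
  have [[_ //]|[s [/(_ tn)-> /(_ y (mem_head _ _)) h]]] := NP n (leq_trans (leq_maxl _ _) Nn).
  have := le_trans (norm_re_le S _) h; rewrite reB reN.
  by rewrite ltr_norml !ler_norml; lra.
have scale1 (y : X) : exists2 c : R, 0 < c & nr (emb c *: y) <= 1.
  have y1 : 0 < nr y + 1 by rewrite ltr_wpDl ?nr_ge0.
  exists (nr y + 1)^-1; first by rewrite invr_gt0.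
  by rewrite nrZ nr_emb gtr0_norm ?invr_gt0// mulrC ler_pdivrMr// mul1r lerDl.
have psi0 t y : (forall n, F n y = 0) -> psi t y = 0.
  have [ptl _] := psi_dual t.
  have step z : (forall n, F n z = 0) -> re (psi t z) = 0.
    move=> Fz; have [c c0 cz] := scale1 z.
    have : c * re (psi t z) = 0.
      rewrite -re_embM -(klinZ ptl); apply: (re_psi t _ cz) => n.
      by rewrite (klinZ (FM n).1) Fz mulr0.
    by move=> /eqP; rewrite mulf_eq0 gt_eqF//= => /eqP.
  move=> Fy; rewrite (re_decomp S (psi t y)) -(klinZ ptl) !step ?rmorph0 ?mulr0 ?subrr//.
  by move=> n; rewrite (klinZ (FM n).1) Fy mulr0.
have [net [netW netP]] := exhausting_nets cW FM.
have [t [x ptx] tnet] : exists2 t, exists x, psi t x <> 0 &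
    forall k x, x \in net k -> psi t x = 0.
  apply: contrapT => nt; apply: unc.
  pose bad (p : nat * nat * nat) :=
    [set t | p.2.+1%:R^-1 <= nr (psi t (nth 0 (net p.1.1) p.1.2))].
  have cbad : countable (\bigcup_(p in [set: nat * nat * nat]) bad p).
    apply: bigcup_countable => [|p _]; first exact: countableP.
    by apply: finite_set_countable; apply: psi_null; rewrite invr_gt0.
  apply: sub_countable cbad; apply: subset_card_le => t [x ptx].
  apply: contrapT => tb; apply: nt; exists t; first by exists x.
  move=> k y yk; apply: contrapT => /eqP pty.
  have p0 : 0 < nr (psi t y) by rewrite nr_gt0.
  have [j jP] := invS_lt p0.
  apply: tb; exists (k, index y (net k), j) => //; rewrite /bad /= nth_index//.
  by rewrite ltW// jP.
apply: ptx; move: x; apply: (determined_eq0 (S := S) cW dW (f := F) (A := setT)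
  (D := [set x | exists k, x \in net k]) (M := M) (N := 2)).
- by [].
- exact: psi_dual.
- by move=> d [k dk]; exact: netW dk.
- by move=> w b e Ww _ e0; exact: netP.
- move=> w z wz; have [ptl _] := psi_dual t.
  apply/eqP; rewrite -subr_eq0 -(klinB ptl); apply/eqP/psi0 => n.
  by rewrite (klinB (FM n).1) wz// subrr.
- by move=> d [k dk]; exact: tnet dk.
Qed.

(** The function [f] is the bounded but not linear [branch_lift psi] minus a linear
  but unbounded representative [L] of the same class: the failure of [f] to be
  affine is that of a bounded function, and [f] takes values in null sequences.
  An affine [a] near [f] would make [a + L] a bounded affine representative,
  contradicting [branch_lift_not_liftable]. *)
Lemma A_const_infinite : A_const (unit_ball X) (c0 K) = +oo%E.
Proof.
rewrite /A_const /infimum; set A := (X in [set c%:E | c in X]).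
rewrite ifT//; apply/eqP; rewrite -subset0 => z [C [C0 CP] _].
have [psi [psi_dual psi_null unc]] := null_family S nonsep cW dW.
pose B := branch_lift psi.
pose Z : set (nat -> K^o) := [set u | vanishing S (u : nat -> K)].
have [a u v u0 v0|a x y|L [Llin LZ]] := @linear_lift K X (nat -> K^o) Z B.
- exact: vanishingD.
- exact: branch_lift_linear.
have /choice[f fE] : forall x, exists u : c0 K, forall n, u n = B x n - L x n.
  by move=> x; apply: (vanishing_c0 (S := S)); exact: LZ.
have cE : C = emb (re C) by rewrite emb_re_ge0.
have nr1P x : unit_ball X x -> nr x <= 1 by rewrite /unit_ball /= -nr_le rmorph1.
have ball1 x : nr x <= 1 -> unit_ball X x by rewrite /unit_ball /= -nr_le rmorph1.
have B2 x n : nr x <= 1 -> nr (B x n) <= 2.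
  move=> x1; rewrite (le_trans (branch_lift_bound psi_dual psi_null x n))//.
  by rewrite ler_piMr.
have c0B2 (s t : K) (u v w : c0 K) n :
  (u - s *: v - t *: w) n = u n - s * v n - t * w n by [].
have c0B (u v : c0 K) n : (u - v) n = u n - v n by [].
have ball_conv x y (t : R) : nr x <= 1 -> nr y <= 1 -> 0 <= t <= 1 ->
    nr (emb t *: x + emb (1 - t) *: y) <= 1.
  move=> x1 y1 /andP[t0 t1]; rewrite (le_trans (nrD _ _ _))// !nrZ !nr_emb.
  rewrite ger0_norm// ger0_norm ?subr_ge0//.
  have := ler_wpM2l t0 x1; have := ler_wpM2l (_ : 0 <= 1 - t) y1.
  by rewrite subr_ge0 => /(_ t1); lra.
have L_conv x y (t : K) n : L (t *: x + (1 - t) *: y) n = t * L x n + (1 - t) * L y n.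
  have LD u v m : L (u + v) m = L u m + L v m.
    by have := congr1 (@^~ m) (Llin 1 u v); rewrite !scale1r.
  have LZ' s u m : L (s *: u) m = s * L u m.
    have L0 : L 0 m = 0 by apply: (addrI (L 0 m)); rewrite -LD !addr0.
    have := congr1 (@^~ m) (Llin s u 0); rewrite addr0 => ->.
    by rewrite /= -[RHS]addr0 -[in RHS]L0.
  by rewrite LD !LZ'.
have [||a aff fa] := CP (emb 6) f.
- by rewrite emb_ge0.
- move=> x y t /nr1P x1 /nr1P y1 t01.
  have tE : t = emb (re t) by rewrite emb_re_ge0//; case/andP: t01.
  have {}t01 : 0 <= re t <= 1.
    by move: t01; rewrite tE re_emb emb_ge0 -(rmorph1 emb) ler_emb.
  rewrite nr_le; apply: c0_le => n.
  rewrite c0B2 !fE L_conv.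
  set y' := t *: x + _; have y1' : nr y' <= 1.
    by rewrite /y' tE -(rmorph1 emb) -rmorphB; exact: ball_conv.
  have -> : B y' n - (t * L x n + (1 - t) * L y n) - t * (B x n - L x n) -
    (1 - t) * (B y n - L y n) = B y' n - t * B x n - (1 - t) * B y n by ring.
  have -> : (6 : R) = 2 + 2 + 2 by lra.
  have /andP[t0 t1] := t01.
  have nt : nr t <= 1 by rewrite tE nr_emb ger0_norm.
  have nt' : nr (1 - t) <= 1.
    by rewrite tE -(rmorph1 emb) -rmorphB nr_emb ger0_norm ?subr_ge0// lerBlDr lerDl.
  rewrite (le_trans (nrB _ _ _))// lerD//.
    rewrite (le_trans (nrB _ _ _))// lerD ?B2// nrM.
    by rewrite (le_trans _ (B2 x n x1))// ler_piMl ?nr_ge0.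
  by rewrite nrM (le_trans _ (B2 y n y1))// ler_piMl ?nr_ge0.
pose m n x : K := a x n + L x n.
have mB n x : m n x = B x n - (f x - a x : c0 K) n by rewrite c0B fE /m; ring.
pose c := 2 + re C * 6.
have mc n x : nr x <= 1 -> nr (m n x) <= c.
  move=> x1; rewrite mB (le_trans (nrB _ _ _))// lerD ?B2//.
  rewrite (le_trans (c0_coord _ _ _))// -nr_le rmorphM -cE.
  by apply: fa; exact: ball1.
have nr00 : nr (0 : X) <= 1 by rewrite nr0.
pose r n x := re (m n x - m n 0).
have r_c n x : nr x <= 1 -> `|r n x| <= c + c.
  move=> x1; rewrite (le_trans (norm_re_le _ _))// (le_trans (nrB _ _ _))//.
  by rewrite lerD// mc.
have r_aff n : real_delta_affine S 0 (r n).
  move=> x y t x1 y1 t01; rewrite normr_le0; apply/eqP.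
  have t01' : 0 <= emb t <= 1 by rewrite -(rmorph1 emb) emb_ge0 ler_emb.
  have := aff x y (emb t) (ball1 _ x1) (ball1 _ y1) t01'.
  rewrite normr_le0 => /eqP/(congr1 (fun u : c0 K => u n)).
  rewrite c0B2 => aE; have {}aE : a (emb t *: x + (1 - emb t) *: y) n =
    emb t * a x n + (1 - emb t) * a y n.
    by apply/eqP; rewrite -subr_eq0 opprD addrA; apply/eqP.
  rewrite /r -!re_embM -!reB rmorphB rmorph1 /m L_conv aE.
  by rewrite -[RHS](re0 S); congr re; ring.
have r0 n : r n 0 = 0 by rewrite /r subrr re0.
have /choice[F FP] : forall n, exists F : X -> K,
    dual_bd S ((c + c) + (c + c)) F /\ forall x, nr x <= 1 -> re (F x) = r n x.
  by move=> n; have [F ? ?] := affine_klin (r_aff n) (r0 n) (r_c n); exists F.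
apply: (branch_lift_not_liftable psi_dual psi_null unc (fun n => (FP n).1)) => x x1.
have := vanishingD (-1) (c0_vanishing S (f x - a x)) (c0_vanishing S (f 0 - a 0)).
apply: (vanishing_le ltr01) => n; rewrite nr_emb mul1r reB (FP n).2//.
rewrite -reB (le_trans (norm_re_le _ _))// le_eqVlt; apply/orP; left; apply/eqP.
congr (nr _); rewrite !mB [B 0 n]branch_lift0// /B; ring.
Qed.

End UnboundedCase.

Theorem corollary1 (R : realType) (K : numFieldType)
    (hK : K = (R : numFieldType) \/ K = (R[i] : numFieldType))
    (X : completeNormedModType K) (nonsep : ~ separable X)
    (wcg : weakly_compactly_generated X) (hX : K_space X) :
  A0_const (unit_ball X) (c0 K) \is a fin_num /\
  A_const (unit_ball X) (c0 K) = +oo%E.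
Proof.
have S : inhabited (real_form R K).
  by case: hK => ->; constructor; [exact: real_form_real|exact: real_form_complex].
case: S => S; have [W cW dW] := wcg; split.
- exact: (A0_const_fin_num S hX cW dW).
- exact: (A_const_infinite S cW dW nonsep).
Qed.
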